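(* Let $\mathfrak{g}=\mathfrak{g}_{\overline 0}\oplus\mathfrak{g}_{\overline 1}$ be a classical Lie superalgebra over $k$ such that $\mathfrak{g}_{\overline 0}$ is a semisimple Lie algebra. Then for any $n\in\mathbb{Z}$ there are only finitely many isomorphism classes of endotrivial modules in $\mathcal{F}_{(\mathfrak{g},\mathfrak{g}_{\overline 0})}$ of dimension $n$.
   Context: $k$ is an algebraically closed field of characteristic $0$. All modules are $\mathbb{Z}_2$-graded (supermodules), and homomorphisms are homogeneous of degree $\overline 0$. A finite dimensional Lie superalgebra $\mathfrak{g}$ is classical if there is a connected reductive algebraic group $G_{\overline 0}$ with $\mathrm{Lie}(G_{\overline 0})=\mathfrak{g}_{\overline 0}$ and an action of $G_{\overline 0}$ on $\mathfrak{g}_{\overline 1}$ which differentiates to the adjoint action of $\mathfrak{g}_{\overline 0}$ on $\mathfrak{g}_{\overline 1}$; in particular $\mathfrak{g}_{\overline 0}$ is reductive. $\mathcal{F}_{(\mathfrak{g},\mathfrak{g}_{\overline 0})}$ is the full subcategory of $\mathfrak{g}$-supermodules whose objects are the finite dimensional supermodules that are completely reducible over $\mathfrak{g}_{\overline 0}$. $k_{ev}$ is the trivial supermodule concentrated in degree $\overline 0$. $M\in\mathcal{F}_{(\mathfrak{g},\mathfrak{g}_{\overline 0})}$ is endotrivial if $M\otimes M^*\cong k_{ev}\oplus P$ with $P$ projective in $\mathcal{F}_{(\mathfrak{g},\mathfrak{g}_{\overline 0})}$. *)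

(* Defs.v *)
From HB Require Import structures.
From mathcomp Require Import all_boot all_order all_algebra.
From mathcomp Require Import mpoly.

Set Implicit Arguments.
Unset Strict Implicit.
Unset Printing Implicit Defensive.

Import GRing.Theory.

Local Open Scope ring_scope.

Lemma linfunE (k : fieldType) (V W : vectType k) (f : V -> W) :
  linear f -> linfun f =1 f.
Proof.
move=> fl; pose L := HB.pack_for {linear V -> W} f
  (GRing.isLinear.Build _ _ _ _ f fl).
exact: (lfunE L).
Qed.

(* The grading group Z/2 is [bool], with addition [(+)] ([addb]); the product
   of two degrees is [&&], so (-1)^(|x||y|) is [(-1) ^+ (a && b)]. *)
Record superSpace (k : fieldType) := SuperSpace {
  sv_vect :> vectType k;
  hpart : bool -> {vspace sv_vect};
  hpart_full : (hpart false + hpart true)%VS = fullv;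
  hpart_cap0 : (hpart false :&: hpart true)%VS = 0%VS
}.

Section SuperSpaceTheory.
Variables (k : fieldType) (V : superSpace k).

Definition hproj (a : bool) : 'End(V) := daddv_pi (hpart V a) (hpart V (~~ a)).

(* For v homogeneous, psgn a v = (-1)^(a|v|) v. *)
Definition psgn (a : bool) : 'End(V) :=
  hproj false + (-1) ^+ a *: hproj true.

Lemma hpart_cap a : (hpart V a :&: hpart V (~~ a) = 0)%VS.
Proof.
have H := hpart_cap0 V.
by case: a => //=; rewrite capvC.
Qed.

Lemma hproj_id a v : v \in hpart V a -> hproj a v = v.
Proof. exact/daddv_pi_id/hpart_cap. Qed.

Lemma hproj_mem a v : hproj a v \in hpart V a.
Proof. exact: memv_pi. Qed.

Lemma hprojD v : hproj false v + hproj true v = v.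
Proof.
rewrite /hproj /= daddv_pi_add ?hpart_full ?memvf //.
exact: (hpart_cap false).
Qed.

Lemma hproj0 a b v : v \in hpart V b -> a != b -> hproj a v = 0.
Proof.
move=> vb; have := hprojD v; case: a b vb => -[] //= vb E _;
  move: E; rewrite (hproj_id vb).
  by move/eqP; rewrite eq_sym addrC -subr_eq subrr => /eqP.
by move/eqP; rewrite eq_sym -subr_eq subrr => /eqP.
Qed.

Lemma hprojE a b v : v \in hpart V b -> hproj a v = if a == b then v else 0.
Proof.
move=> vb; case: eqP => [->|/eqP ab]; first exact: hproj_id.
exact: hproj0 vb ab.
Qed.

Lemma psgnE a b v : v \in hpart V b -> psgn a v = (-1) ^+ (a && b) *: v.
Proof.
move=> vb; rewrite add_lfunE scale_lfunE !(hprojE _ vb).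
by case: b vb => _ /=; rewrite ?andbT ?andbF ?expr0 ?scale1r ?scaler0 ?addr0 ?add0r.
Qed.

Lemma hpart_ind (P : V -> Prop) :
  (forall u v, P u -> P v -> P (u + v)) ->
  (forall a v, v \in hpart V a -> P v) -> forall v, P v.
Proof.
by move=> PD Ph v; rewrite -(hprojD v); apply: PD; apply: Ph; apply: hproj_mem.
Qed.

End SuperSpaceTheory.

Lemma grading_of_proj (k : fieldType) (V : vectType k) (U : bool -> {vspace V})
    (p : bool -> 'End(V)) :
  (forall v, p false v + p true v = v) ->
  (forall a v, p a v \in U a) ->
  (forall a v, v \in U (~~ a) -> p a v = 0) ->
  (U false + U true)%VS = fullv /\ (U false :&: U true)%VS = 0%VS.
Proof.
move=> pD pU p0; split.
  apply/eqP; rewrite eqEsubv subvf /=; apply/subvP => v _.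
  by rewrite -(pD v) memv_add.
apply/eqP; rewrite -subv0; apply/subvP => v.
rewrite memv_cap memv0 => /andP[v0 v1].
by rewrite -(pD v) (p0 false v v1) (p0 true v v0) addr0.
Qed.

Section GroundField.
Variable k : fieldType.

Lemma ksup_subproof (h := fun a : bool => if a then 0%VS else fullv : {vspace k^o}) :
  (h false + h true)%VS = fullv /\ (h false :&: h true)%VS = 0%VS.
Proof. by split; [exact: addv0 | exact: capv0]. Qed.

Definition ksup : superSpace k :=
  SuperSpace ksup_subproof.1 ksup_subproof.2.

End GroundField.

Section DirectSum.
Variables (k : fieldType) (V W : superSpace k).

Definition dsum_fst : 'Hom((V * W)%type, V) := linfun fst.
Definition dsum_snd : 'Hom((V * W)%type, W) := linfun snd.

Definition dsum_part (a : bool) : {vspace (V * W)%type} :=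
  (dsum_fst @^-1: hpart V a :&: dsum_snd @^-1: hpart W a)%VS.

Lemma mem_dsum_part a u :
  (u \in dsum_part a) = (u.1 \in hpart V a) && (u.2 \in hpart W a).
Proof. by rewrite memv_cap -!memv_preim !lfunE. Qed.

Lemma dsum_subproof :
  (dsum_part false + dsum_part true)%VS = fullv /\
  (dsum_part false :&: dsum_part true)%VS = 0%VS.
Proof.
pose p a (u : V * W) : V * W := (hproj V a u.1, hproj W a u.2).
have pl a : linear (p a).
  by move=> c u v; rewrite /p /= !linearP.
apply: (@grading_of_proj _ _ dsum_part (fun a => linfun (p a))).
- by case=> v w; rewrite !linfunE // /p /=; congr pair; rewrite /= hprojD.
- by move=> a v; rewrite linfunE // mem_dsum_part /= !hproj_mem.
- move=> a v; rewrite mem_dsum_part => /andP[v1 v2]; rewrite linfunE // /p.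
  by rewrite (hproj0 v1) ?(hproj0 v2) //; case: (a).
Qed.

Definition dsum_space : superSpace k :=
  SuperSpace dsum_subproof.1 dsum_subproof.2.

End DirectSum.

Section Dual.
Variables (k : fieldType) (V : superSpace k).

Definition dual_restr (a : bool) : 'End('Hom(V, k^o)) :=
  linfun (fun f : 'Hom(V, k^o) => (f \o hproj V a)%VF).

Definition dual_part (a : bool) : {vspace 'Hom(V, k^o)} :=
  lker (dual_restr (~~ a)).

Lemma dual_restr_linear a :
  linear (fun f : 'Hom(V, k^o) => (f \o hproj V a)%VF).
Proof. by move=> c f g; rewrite comp_lfunDl comp_lfunZl. Qed.

Lemma dual_restrE a f : dual_restr a f = (f \o hproj V a)%VF.
Proof.
exact: (linfunE (dual_restr_linear a)).
Qed.

Lemma mem_dual_partP a (f : 'Hom(V, k^o)) :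
  reflect (forall v, v \in hpart V (~~ a) -> f v = 0) (f \in dual_part a).
Proof.
rewrite memv_ker dual_restrE; apply: (iffP eqP) => [f0 v va|f0].
  by have /lfunP/(_ v) := f0; rewrite comp_lfunE hproj_id // zero_lfunE.
apply/lfunP=> v; rewrite comp_lfunE zero_lfunE f0 //; exact: hproj_mem.
Qed.

Lemma dual_subproof :
  (dual_part false + dual_part true)%VS = fullv /\
  (dual_part false :&: dual_part true)%VS = 0%VS.
Proof.
apply: (@grading_of_proj _ _ _ dual_restr).
- move=> f; rewrite !dual_restrE -comp_lfunDr.
  apply/lfunP=> v; rewrite comp_lfunE add_lfunE hprojD //.
- move=> a f; apply/mem_dual_partP => v va.
  by rewrite dual_restrE comp_lfunE (hproj0 va) ?linear0 //; case: (a).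
- move=> a f /mem_dual_partP f0; rewrite dual_restrE.
  apply/lfunP=> v; rewrite comp_lfunE zero_lfunE f0 // negbK; exact: hproj_mem.
Qed.

Definition dual_space : superSpace k :=
  SuperSpace dual_subproof.1 dual_subproof.2.

End Dual.

(* V (x) W is the space of matrices indexed by the bases [vbasis fullv] of V and
   W, with v (x) w the rank-one matrix of products of coordinates.  The universal
   property is [tliftE] and [tens_ext] below. *)
Section Tensor.
Variables (k : fieldType) (V W : vectType k).

Let m := \dim {:V}.
Let n := \dim {:W}.
Let bV : m.-tuple V := vbasis {:V}.
Let bW : n.-tuple W := vbasis {:W}.

Definition tens : vectType k := 'M[k]_(\dim {:V}, \dim {:W}).

Definition tprod (v : V) (w : W) : tens :=
  \matrix_(i, j) (coord (vbasis {:V}) i v * coord (vbasis {:W}) j w).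

Definition tlift (U : vectType k) (b : V -> W -> U) : 'Hom(tens, U) :=
  linfun (fun X : 'M[k]_(\dim {:V}, \dim {:W}) =>
    \sum_i \sum_j X i j *: b (vbasis {:V})`_i (vbasis {:W})`_j).

Definition bilin (U : vectType k) (b : V -> W -> U) :=
  (forall w, linear (b^~ w)) /\ (forall v, linear (b v)).

Lemma tprod_bilin : bilin tprod.
Proof.
split=> [w c u v|v c u w]; apply/matrixP=> i j; rewrite !mxE linearP.
  by rewrite mulrDl mulrA.
by rewrite mulrDr mulrCA.
Qed.

Lemma tprodDl u v w : tprod (u + v) w = tprod u w + tprod v w.
Proof. by have := tprod_bilin.1 w 1 u v; rewrite !scale1r. Qed.

Lemma tprodDr v u w : tprod v (u + w) = tprod v u + tprod v w.
Proof. by have := tprod_bilin.2 v 1 u w; rewrite !scale1r. Qed.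

Lemma tprod0l w : tprod 0 w = 0.
Proof. by apply/matrixP=> i j; rewrite !mxE linear0 mul0r. Qed.

Lemma tprod0r v : tprod v 0 = 0.
Proof. by apply/matrixP=> i j; rewrite !mxE linear0 mulr0. Qed.

Lemma tprodZl c v w : tprod (c *: v) w = c *: tprod v w.
Proof. by have := tprod_bilin.1 w c v 0; rewrite !addr0 tprod0l addr0. Qed.

Lemma tprodZr c v w : tprod v (c *: w) = c *: tprod v w.
Proof. by have := tprod_bilin.2 v c w 0; rewrite !addr0 tprod0r addr0. Qed.

Lemma bilin_sumZ (U : vectType k) (b : V -> W -> U) (v : V) (w : W) :
  bilin b ->
  b v w = \sum_i \sum_j (coord bV i v * coord bW j w) *: b bV`_i bW`_j.
Proof.
move=> [bl br].
rewrite {1}(coord_vbasis (memvf v)) -[b _ w](linfunE (bl w)) linear_sum.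
apply: eq_bigr => i _; rewrite linearZ /= linfunE //.
rewrite {1}(coord_vbasis (memvf w)) -[b _ (\sum__ _)](linfunE (br _)).
rewrite linear_sum scaler_sumr.
by apply: eq_bigr => j _; rewrite linearZ /= linfunE // scalerA.
Qed.

Lemma tlift_raw (U : vectType k) (b : V -> W -> U) (X : 'M[k]_(m, n)) :
  tlift b X = \sum_i \sum_j X i j *: b bV`_i bW`_j.
Proof.
pose F (X : 'M[k]_(m, n)) : U := \sum_i \sum_j X i j *: b bV`_i bW`_j.
have Fl : linear F.
  move=> c A B; rewrite /F scaler_sumr -big_split; apply: eq_bigr => i _ /=.
  rewrite scaler_sumr -big_split; apply: eq_bigr => j _ /=.
  by rewrite !mxE scalerDl scalerA.
exact: (linfunE Fl).
Qed.

Lemma tliftE (U : vectType k) (b : V -> W -> U) v w :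
  bilin b -> tlift b (tprod v w) = b v w.
Proof.
move=> bb; rewrite tlift_raw (bilin_sumZ v w bb).
by apply: eq_bigr => i _; apply: eq_bigr => j _; rewrite mxE.
Qed.

Lemma tens_sum (X : tens) : exists c : 'I_m -> 'I_n -> k,
  X = \sum_i \sum_j c i j *: tprod bV`_i bW`_j.
Proof.
exists (X : 'M_(_, _)); rewrite {1}[X](@matrix_sum_delta k).
apply: eq_bigr => i _; apply: eq_bigr => j _; congr (_ *: _).
have fV : free bV := basis_free (vbasisP _).
have fW : free bW := basis_free (vbasisP _).
apply/matrixP=> i' j'; rewrite !mxE !coord_free // -natrM mulnb.
by rewrite ![_ == i']eq_sym ![_ == j']eq_sym.
Qed.

Lemma tens_ext (U : vectType k) (f g : 'Hom(tens, U)) :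
  (forall v w, f (tprod v w) = g (tprod v w)) -> f = g.
Proof.
move=> fg; apply/lfunP => X; have [c ->] := tens_sum X.
rewrite !linear_sum; apply: eq_bigr => i _; rewrite !linear_sum.
by apply: eq_bigr => j _; rewrite !linearZ /= fg.
Qed.

Definition tens_sub (A : {vspace V}) (B : {vspace W}) : {vspace tens} :=
  <<[seq tprod v w | v <- vbasis A, w <- vbasis B]>>%VS.

Lemma mem_tens_sub (A : {vspace V}) (B : {vspace W}) v w :
  v \in A -> w \in B -> tprod v w \in tens_sub A B.
Proof.
have [tl tr] := tprod_bilin.
move=> /coord_vbasis -> /coord_vbasis ->.
rewrite -[tprod _ _](linfunE (tl _)) linear_sum; apply: memv_suml => i _.
rewrite linearZ /=; apply: memvZ; rewrite linfunE //.
rewrite -[tprod _ _](linfunE (tr _)) linear_sum; apply: memv_suml => j _.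
rewrite linearZ /=; apply: memvZ; rewrite linfunE //; apply: memv_span.
by apply: allpairs_f; apply: mem_nth; rewrite size_tuple.
Qed.

Lemma tens_sub_ind (A : {vspace V}) (B : {vspace W}) (U : {vspace tens}) :
  (forall v w, v \in A -> w \in B -> tprod v w \in U) -> (tens_sub A B <= U)%VS.
Proof.
move=> H; apply/span_subvP => _ /allpairsP[[v w] [/= vA wB ->]].
by apply: H; apply: vbasis_mem.
Qed.

End Tensor.

Arguments tprod {k V W}.
Arguments tlift {k V W U}.
Arguments bilin {k V W U}.

Section TensorSuper.
Variables (k : fieldType) (V W : superSpace k).

Definition tens_part (c : bool) : {vspace tens V W} :=
  (\sum_(a : bool) tens_sub (hpart V a) (hpart W (a (+) c)))%VS.

Lemma mem_tens_part a b v w :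
  v \in hpart V a -> w \in hpart W b -> tprod v w \in tens_part (a (+) b).
Proof.
move=> va wb; rewrite /tens_part; apply/(subvP (@sumv_sup _ _ _ a _ _ _ _ _)) => //.
by apply: mem_tens_sub; rewrite // addbA addbb.
Qed.

Lemma tens_part_ind c (U : {vspace tens V W}) :
  (forall a v w, v \in hpart V a -> w \in hpart W (a (+) c) ->
     tprod v w \in U) -> (tens_part c <= U)%VS.
Proof.
move=> H; apply/subv_sumP => a _; apply: tens_sub_ind => v w va wb.
exact: H va wb.
Qed.

Lemma tens_super_subproof :
  (tens_part false + tens_part true)%VS = fullv /\
  (tens_part false :&: tens_part true)%VS = 0%VS.
Proof.
have [tl tr] := @tprod_bilin k V W.
pose p c (v : V) (w : W) : tens V W :=
  \sum_(a : bool) tprod (hproj V a v) (hproj W (a (+) c) w).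
have pb c : bilin (p c).
  split=> [w d u v|v d u w]; rewrite /p scaler_sumr -big_split;
    apply: eq_bigr => a _ /=; rewrite linearP.
    exact: tl.
  exact: tr.
have ph c a b v w : v \in hpart V a -> w \in hpart W b ->
    p c v w = if c == a (+) b then tprod v w else 0.
  move=> va wb; rewrite /p big_bool /= !(hprojE _ va) !(hprojE _ wb).
  by case: a b c {va wb} => -[] [] /=; rewrite ?tprod0l ?tprod0r ?addr0 ?add0r.
apply: (@grading_of_proj _ _ tens_part (fun c => tlift (p c))).
- move=> X; rewrite -add_lfunE; transitivity (\1%VF X); last by rewrite id_lfunE.
  congr (fun_of_lfun _ X); apply: tens_ext => v w.
  rewrite add_lfunE id_lfunE !tliftE // /p !big_bool /=.
  by rewrite addrACA -!tprodDr hprojD [hproj W true w + _]addrC hprojD addrC -tprodDl hprojD.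
- move=> c X; have [d ->] := tens_sum X; rewrite linear_sum memv_suml // => i _.
  rewrite linear_sum memv_suml // => j _; rewrite linearZ memvZ //= tliftE //.
  rewrite /p memv_suml // => a _.
  by rewrite -[c in tens_part c](addKb a); apply: mem_tens_part; apply: hproj_mem.
- move=> c X XU; apply/eqP; rewrite -memv_ker; move: X XU; apply/subvP.
  apply: tens_part_ind => a v w va wb; rewrite memv_ker tliftE //.
  by rewrite (ph _ _ _ _ _ va wb); case: (a) (c) => -[].
Qed.

Definition tens_space : superSpace k :=
  SuperSpace tens_super_subproof.1 tens_super_subproof.2.

End TensorSuper.

Record lieSuper (k : fieldType) := LieSuper {
  ls_space :> superSpace k;
  lbr : 'Hom(ls_space, 'End(ls_space));
  lbr_graded : forall a b x y, x \in hpart ls_space a -> y \in hpart ls_space b ->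
    lbr x y \in hpart ls_space (a (+) b);
  lbr_skew : forall a b x y, x \in hpart ls_space a -> y \in hpart ls_space b ->
    lbr x y = - ((-1) ^+ (a && b) *: lbr y x);
  lbr_jacobi : forall a b c x y z,
    x \in hpart ls_space a -> y \in hpart ls_space b -> z \in hpart ls_space c ->
    lbr x (lbr y z) = lbr (lbr x y) z + (-1) ^+ (a && b) *: lbr y (lbr x z)
}.
Arguments lbr {k g} : rename.

Record smod (k : fieldType) (g : lieSuper k) := SMod {
  sm_space :> superSpace k;
  act : 'Hom(g, 'End(sm_space));
  act_graded : forall a b x m, x \in hpart g a -> m \in hpart sm_space b ->
    act x m \in hpart sm_space (a (+) b);
  act_lbr : forall a b x y m, x \in hpart g a -> y \in hpart g b ->
    act (lbr x y) m = act x (act y m) - (-1) ^+ (a && b) *: act y (act x m)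
}.
Arguments act {k g m} : rename.

Definition smod_hom (k : fieldType) (g : lieSuper k) (M N : smod g)
    (f : 'Hom(M, N)) : Prop :=
  (forall a m, m \in hpart M a -> f m \in hpart N a) /\
  (forall x m, f (act x m) = act x (f m)).

Definition smod_iso (k : fieldType) (g : lieSuper k) (M N : smod g) : Prop :=
  exists f : 'Hom(M, N), smod_hom f /\ bijective f.

Section Trivial.
Variables (k : fieldType) (g : lieSuper k).

Lemma kev_graded a b x (m : ksup k) : x \in hpart g a -> m \in hpart (ksup k) b ->
  (0 : 'Hom(g, 'End(ksup k))) x m \in hpart (ksup k) (a (+) b).
Proof. by rewrite zero_lfunE zero_lfunE mem0v. Qed.

Lemma kev_lbr a b x y (m : ksup k) (z : 'Hom(g, 'End(ksup k)) := 0) :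
  x \in hpart g a -> y \in hpart g b ->
  z (lbr x y) m = z x (z y m) - (-1) ^+ (a && b) *: z y (z x m).
Proof. by rewrite /z !zero_lfunE scaler0 subr0. Qed.

Definition kev : smod g := SMod kev_graded kev_lbr.

End Trivial.

Section DirectSumModule.
Variables (k : fieldType) (g : lieSuper k) (M N : smod g).

Definition dsum_act1 (x : g) : 'End((M * N)%type) :=
  linfun (fun u : M * N => (act x u.1, act x u.2)).

Definition dsum_act : 'Hom(g, 'End(dsum_space M N)) := linfun dsum_act1.

Lemma dsum_actE x u : dsum_act x u = (act x u.1, act x u.2).
Proof.
have l1 y : linear (fun u : M * N => (act y u.1, act y u.2)).
  by move=> c v w; rewrite /= !linearP.
have E y v : dsum_act1 y v = (act y v.1, act y v.2) by exact: (linfunE (l1 y)).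
have l2 : linear dsum_act1.
  move=> c y z; apply/lfunP => v; rewrite add_lfunE scale_lfunE !E.
  by rewrite !linearP !add_lfunE !scale_lfunE.
rewrite -E; congr (fun_of_lfun _ u); exact: (linfunE l2).
Qed.

Lemma dsum_graded a b x m :
  x \in hpart g a -> m \in hpart (dsum_space M N) b ->
  dsum_act x m \in hpart (dsum_space M N) (a (+) b).
Proof.
move=> xa; rewrite dsum_actE /= !mem_dsum_part /= => /andP[m1 m2].
by rewrite (act_graded xa m1) (act_graded xa m2).
Qed.

Lemma dsum_lbr a b x y m : x \in hpart g a -> y \in hpart g b ->
  dsum_act (lbr x y) m =
    dsum_act x (dsum_act y m) - (-1) ^+ (a && b) *: dsum_act y (dsum_act x m).
Proof.
by move=> xa yb; rewrite !dsum_actE /= !(act_lbr _ xa yb).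
Qed.

Definition dsum_smod : smod g := SMod dsum_graded dsum_lbr.

End DirectSumModule.

Section DualModule.
Variables (k : fieldType) (g : lieSuper k) (M : smod g).

(* On homogeneous elements, (x f)(m) = - (-1)^(|x||f|) f (x m): see
   [dual_act_hom]. *)
Definition dual_act1 (x : g) : 'End(dual_space M) :=
  linfun (fun f : dual_space M =>
    - \sum_(a : bool) (psgn (dual_space M) a f \o act (hproj g a x))%VF).

Definition dual_act : 'Hom(g, 'End(dual_space M)) := linfun dual_act1.

Lemma dual_actE x (f : dual_space M) :
  dual_act x f =
    - \sum_(a : bool) (psgn (dual_space M) a f \o act (hproj g a x))%VF.
Proof.
pose F y (f : dual_space M) : dual_space M :=
  - \sum_(a : bool) (psgn (dual_space M) a f \o act (hproj g a y))%VF.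
have l1 y : linear (F y).
  move=> c u v; rewrite /F scalerN -opprD scaler_sumr -big_split; congr (- _).
  by apply: eq_bigr => a _; rewrite /= linearP comp_lfunDl comp_lfunZl.
have E y v : dual_act1 y v = F y v by exact: (linfunE (l1 y)).
have l2 : linear dual_act1.
  move=> c y z; apply/lfunP => v; rewrite add_lfunE scale_lfunE !E /F.
  rewrite scalerN -opprD scaler_sumr -big_split; congr (- _).
  by apply: eq_bigr => a _; rewrite /= !linearP comp_lfunDr comp_lfunZr.
rewrite -[RHS]/(F x f) -E; congr (fun_of_lfun _ f); exact: (linfunE l2).
Qed.

Lemma dual_act_hom a b x (f : dual_space M) m :
  x \in hpart g a -> f \in hpart (dual_space M) b ->
  dual_act x f m = - ((-1) ^+ (a && b) *: f (act x m)).
Proof.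
move=> xa fb; rewrite dual_actE opp_lfunE sum_lfunE; congr (- _).
rewrite big_bool /= !comp_lfunE !(psgnE _ fb) !scale_lfunE !(hprojE _ xa).
by case: a xa => _ /=; rewrite linear0 zero_lfunE linear0 scaler0 ?addr0 ?add0r.
Qed.

Lemma dual_graded a b x m :
  x \in hpart g a -> m \in hpart (dual_space M) b ->
  dual_act x m \in hpart (dual_space M) (a (+) b).
Proof.
move=> xa fb; apply/mem_dual_partP => v vb.
rewrite (dual_act_hom v xa fb) (mem_dual_partP _ _ fb) ?scaler0 ?oppr0 //.
have := act_graded xa vb; suff -> : a (+) ~~ (a (+) b) = ~~ b by [].
by case: (a) (b) => -[].
Qed.

Lemma dual_lbr a b x y m : x \in hpart g a -> y \in hpart g b ->
  dual_act (lbr x y) m =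
    dual_act x (dual_act y m) - (-1) ^+ (a && b) *: dual_act y (dual_act x m).
Proof.
move=> xa yb; move: m; apply: (@hpart_ind _ (dual_space M)).
  move=> u v Eu Ev; rewrite !linearD /= Eu Ev.
  by rewrite addrACA.
move=> c f fc; apply/lfunP => m.
have xya := lbr_graded xa yb.
rewrite (dual_act_hom m xya fc) add_lfunE opp_lfunE scale_lfunE.
rewrite (dual_act_hom m xa (dual_graded yb fc)).
rewrite (dual_act_hom m yb (dual_graded xa fc)).
rewrite (dual_act_hom _ yb fc) (dual_act_hom _ xa fc) (act_lbr m xa yb).
rewrite linearB linearZ /= !scalerN !opprK.
case: a b c {xya xa yb fc} => -[] [] /=;
  by rewrite !(expr0, expr1, scale1r, scaleN1r, linearN, opprK, opprD) /=
    ?opprK addrC.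
Qed.

Definition dual_smod : smod g := SMod dual_graded dual_lbr.

End DualModule.

Section TensorModule.
Variables (k : fieldType) (g : lieSuper k) (M N : smod g).

(* On homogeneous elements,
   x (m (x) n) = x m (x) n + (-1)^(|x||m|) m (x) x n: see [tens_act_hom]. *)
Definition tens_act1 (x : g) : 'End(tens_space M N) :=
  tlift (fun m n => tprod (act x m) n +
    \sum_(a : bool) tprod (psgn M a m) (act (hproj g a x) n)).

Definition tens_act : 'Hom(g, 'End(tens_space M N)) := linfun tens_act1.

Lemma tens_actE x m n : tens_act x (tprod m n) =
  tprod (act x m) n + \sum_(a : bool) tprod (psgn M a m) (act (hproj g a x) n).
Proof.
have [tl tr] := @tprod_bilin k M N.
pose F y (m : M) (n : N) : tens M N := tprod (act y m) n +
    \sum_(a : bool) tprod (psgn M a m) (act (hproj g a y) n).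
have Fb y : bilin (F y).
  split=> [w c u v|v c u w]; rewrite /F scalerDr addrACA scaler_sumr -big_split.
    congr (_ + _); first by rewrite linearP; apply: tl.
    by apply: eq_bigr => a _; rewrite linearP; apply: tl.
  congr (_ + _); first exact: tr.
  by apply: eq_bigr => a _; rewrite linearP; apply: tr.
have E y (u : M) (v : N) : tens_act1 y (tprod u v) = F y u v by exact: (tliftE u v (Fb y)).
have l2 : linear tens_act1.
  move=> c y z; apply: tens_ext => u v; rewrite add_lfunE scale_lfunE !E /F.
  rewrite scalerDr addrACA scaler_sumr -big_split; congr (_ + _).
    by rewrite linearP add_lfunE scale_lfunE; apply: tl.
  apply: eq_bigr => a _; rewrite -[RHS]tr; congr (tprod _ _).
  by rewrite !linearP add_lfunE scale_lfunE.
rewrite -[RHS]/(F x m n) -E; congr (fun_of_lfun _ _); exact: (linfunE l2).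
Qed.

Lemma tens_act_hom a b x m n : x \in hpart g a -> m \in hpart M b ->
  tens_act x (tprod m n) =
    tprod (act x m) n + (-1) ^+ (a && b) *: tprod m (act x n).
Proof.
move=> xa mb; rewrite tens_actE; congr (_ + _).
rewrite big_bool /= !(psgnE _ mb) !(hprojE _ xa).
by case: a xa => _ /=; rewrite linear0 zero_lfunE tprod0r tprodZl ?addr0 ?add0r.
Qed.

Lemma tens_graded a b x m :
  x \in hpart g a -> m \in hpart (tens_space M N) b ->
  tens_act x m \in hpart (tens_space M N) (a (+) b).
Proof.
move=> xa; rewrite memv_preim; move: m; apply/subvP.
apply: tens_part_ind => c v w vc wb; rewrite -memv_preim.
rewrite (tens_act_hom w xa vc); apply: memvD.
  have := mem_tens_part (act_graded xa vc) wb.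
  by rewrite addbA -[_ (+) c (+) c]addbA addbb addbF.
apply: memvZ; have := mem_tens_part vc (act_graded xa wb).
by rewrite addbCA [c (+) (c (+) b)]addbA addbb.
Qed.

Lemma tens_lbr a b x y m : x \in hpart g a -> y \in hpart g b ->
  tens_act (lbr x y) m =
    tens_act x (tens_act y m) - (-1) ^+ (a && b) *: tens_act y (tens_act x m).
Proof.
move=> xa yb; rewrite -!comp_lfunE -scale_lfunE -opp_lfunE -add_lfunE.
congr (fun_of_lfun _ _); apply: tens_ext => v w.
move: v; apply: hpart_ind => [u v|c v vc].
  by move=> Eu Ev; rewrite tprodDl !linearD /= Eu Ev.
rewrite add_lfunE opp_lfunE scale_lfunE !comp_lfunE.
rewrite (tens_act_hom _ (lbr_graded xa yb) vc) (tens_act_hom _ xa vc).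
rewrite (tens_act_hom _ yb vc) !linearD !linearZ /=.
rewrite (tens_act_hom _ xa (act_graded yb vc)) (tens_act_hom _ xa vc).
rewrite (tens_act_hom _ yb (act_graded xa vc)) (tens_act_hom _ yb vc).
rewrite !(act_lbr _ xa yb) -!scaleNr tprodDl tprodDr tprodZl tprodZr.
set A := tprod _ _; set B := tprod _ _; set C := tprod v _; set D := tprod v _.
set E := tprod _ _; set F := tprod _ _.
have sumE (p q r s t u : tens M N) :
    p + t + (u + r) + (q - u + (- t + s)) = p + q + (r + s).
  rewrite [u + r]addrC [_ - u + _]addrC addrACA [_ + (- t + s)]addrA addrK.
  by rewrite [q - u]addrC [_ + (- u + q)]addrA addrK [r + q]addrC addrACA [s + r]addrC.
case: a b c {xa yb vc} => -[] [] /=;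
  rewrite !(expr0, expr1, scale1r, scaleN1r, opprK, opprD) /= ?opprK.
- by rewrite -(sumE A B C D E (- F)) opprK.
- by rewrite -(sumE A B C D (- E) F) opprK.
- by rewrite -(sumE A (- B) (- C) D (- E) F) opprK.
- by rewrite -(sumE A (- B) C (- D) E F).
- by rewrite -(sumE A (- B) (- C) D E (- F)) opprK.
- by rewrite -(sumE A (- B) C (- D) E F).
- by rewrite -(sumE A (- B) C (- D) E F).
- by rewrite -(sumE A (- B) C (- D) E F).
Qed.

Definition tens_smod : smod g := SMod tens_graded tens_lbr.

End TensorModule.

Section CategoryF.
Variables (k : fieldType) (g : lieSuper k).

(* The submodules are Z/2-graded, as all modules are. *)
Definition ev_submod (M : smod g) (U : {vspace M}) : Prop :=
  (U <= (U :&: hpart M false) + (U :&: hpart M true))%VS /\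
  (forall x u, x \in hpart g false -> u \in U -> act x u \in U).

Definition ev_completely_reducible (M : smod g) : Prop :=
  forall U : {vspace M}, ev_submod U ->
    exists W : {vspace M},
      [/\ ev_submod W, (U + W)%VS = fullv & (U :&: W)%VS = 0%VS].

(* Objects of [smod g] are finite dimensional because [vectType] is. *)
Definition inF (M : smod g) : Prop := ev_completely_reducible M.

Definition projectiveF (P : smod g) : Prop :=
  inF P /\
  forall (M N : smod g) (f : 'Hom(M, N)) (h : 'Hom(P, N)),
    inF M -> inF N -> smod_hom f -> smod_hom h -> limg f = fullv ->
    exists h' : 'Hom(P, M), smod_hom h' /\ (f \o h')%VF = h.

Definition endotrivial (M : smod g) : Prop :=
  inF M /\
  exists P : smod g, projectiveF P /\
    smod_iso (tens_smod M (dual_smod M)) (dsum_smod (kev g) P).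

End CategoryF.

Section Semisimple.
Variables (k : fieldType) (g : lieSuper k).

Definition lbrv (U W : {vspace g}) : {vspace g} :=
  <<[seq lbr u w | u <- vbasis U, w <- vbasis W]>>%VS.

Definition ev_ideal (I : {vspace g}) : Prop :=
  (I <= hpart g false)%VS /\ (lbrv (hpart g false) I <= I)%VS.

Definition lsolvable (I : {vspace g}) : Prop :=
  exists n, iter n (fun U => lbrv U U) I = 0%VS.

Definition ev_semisimple : Prop :=
  forall I : {vspace g}, ev_ideal I -> lsolvable I -> I = 0%VS.

End Semisimple.

(* Algebraic groups over the algebraically closed field k are identified with
   their groups of k-points: Zariski closed subgroups of GL_n(k). *)
Section AlgebraicGroups.
Variables (k : closedFieldType) (n : nat).
Implicit Types (f : {mpoly k[n * n]}) (A B X : 'M[k]_n).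
Implicit Types (Z G : 'M[k]_n -> Prop).

Definition mxeval f A : k := f.@[fun i => mxvec A 0 i].

(* Differential at the identity matrix, in the direction X. *)
Definition mxdiff f X : k :=
  \sum_(i < n * n) mxeval f^`M(i) 1%:M * mxvec X 0 i.

(* Polynomials in the entries suffice, as det is invertible on GL_n. *)
Definition GLclosed Z : Prop :=
  exists S : {mpoly k[n * n]} -> Prop,
    forall A, Z A <-> A \in unitmx /\ forall f, S f -> mxeval f A = 0.

Definition alg_group G : Prop :=
  [/\ GLclosed G, G 1%:M, forall A B, G A -> G B -> G (A *m B)
    & forall A, G A -> G (invmx A)].

Definition zconnected Z : Prop :=
  forall Z1 Z2, GLclosed Z1 -> GLclosed Z2 ->
    (forall A, Z A -> Z1 A \/ Z2 A) ->
    (forall A, Z A -> ~ (Z1 A /\ Z2 A)) ->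
    (forall A, Z A -> Z1 A) \/ (forall A, Z A -> Z2 A).

Definition unipotent_mx A : Prop := exists m, (A - 1%:M) ^+ m = 0.

(* The unipotent radical is trivial. *)
Definition reductive G : Prop :=
  forall U, alg_group U -> zconnected U -> (forall A, U A -> G A) ->
    (forall A B, G A -> U B -> U (A *m B *m invmx A)) ->
    (forall A, U A -> unipotent_mx A) ->
    forall A, U A -> A = 1%:M.

(* The tangent space at the identity. *)
Definition LieAlg G X : Prop :=
  forall f, (forall A, G A -> mxeval f A = 0) -> mxdiff f X = 0.

(* The regular functions on G are the restrictions of f / det^m; the second
   component is the value at X of their differential at the identity. *)
Definition regeval f (m : nat) A : k := mxeval f A / \det A ^+ m.

Definition regdiff f (m : nat) X : k :=
  mxdiff f X - (\tr X *+ m) * mxeval f 1%:M.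

End AlgebraicGroups.

Section Classical.
Variables (k : closedFieldType) (g : lieSuper k).

(* iota identifies the even part of g with Lie(G). *)
Definition ev_lie_iso n (G : 'M[k]_n -> Prop) (iota : 'Hom(g, 'M[k]_n)) : Prop :=
  [/\ {in hpart g false &, injective iota},
      forall X, LieAlg G X <-> exists2 x, x \in hpart g false & iota x = X
    & {in hpart g false &, forall x y,
        iota (lbr x y) = iota x *m iota y - iota y *m iota x}].

(* rho is a rational representation of G on the odd part of g, whose
   differential is the adjoint action: rationality and the differential are
   expressed through the matrix coefficients l (rho A v). *)
Definition odd_action n (G : 'M[k]_n -> Prop) (iota : 'Hom(g, 'M[k]_n))
    (rho : 'M[k]_n -> 'End(g)) : Prop :=
  [/\ forall A v, G A -> v \in hpart g true -> rho A v \in hpart g true,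
      forall v, v \in hpart g true -> rho 1%:M v = v,
      forall A B v, G A -> G B -> v \in hpart g true ->
        rho (A *m B) v = rho A (rho B v)
    & forall v (l : 'Hom(g, k^o)), v \in hpart g true ->
        exists f m, (forall A, G A -> l (rho A v) = regeval f m A) /\
          (forall x, x \in hpart g false -> l (lbr x v) = regdiff f m (iota x))].

Definition classical : Prop :=
  exists (n : nat) (G : 'M[k]_n -> Prop) (iota : 'Hom(g, 'M[k]_n))
         (rho : 'M[k]_n -> 'End(g)),
    [/\ alg_group G, zconnected G, reductive G, ev_lie_iso G iota
      & odd_action G iota rho].

End Classical.

(* Main.v *)
Require Import Defs.
From HB Require Import structures.
From mathcomp Require Import all_boot all_order all_algebra.
From Stdlib Require Import Classical ClassicalEpsilon.

Set Implicit Arguments.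
Unset Strict Implicit.
Unset Printing Implicit Defensive.

Import GRing.Theory Num.Theory.
Local Open Scope ring_scope.

(**
An endotrivial module is rigid, and finitely many isomorphism classes of rigid
modules exist in each dimension.

Rigidity.  If [M (x) M^*] is [k_ev (+) P] with [P] projective, then
[Ext^1(M, M) = Ext^1(M (x) M^*, k_ev) = Ext^1(k_ev, k_ev)].  An even extension
of [k_ev] by itself is killed by the odd part for reasons of parity and by the
even part because the latter is perfect, so this group vanishes.  Concretely,
an even derivation [F] from [g] to [End(M)] defines an extension of
[M (x) M^*] by the trivial module ([cocycle_ext]); a splitting is a linear form
on [M (x) M^*], that is, an endomorphism of [M], and it exhibits [F] as an inner
derivation ([endotrivial_cocycle_inner]).  Projectivity of [P] can be applied
because every supermodule is completely reducible over the semisimple even part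
([weyl]).  Weyl's theorem follows from Whitehead's first lemma
([whitehead_sub]), which is proved with a Casimir element and rests on Cartan's
criterion ([cartan_criterion]), hence on Engel's theorem ([engel]).

Finiteness.  A supermodule of dimension [n] is a representation by matrices of
size [n] of a finitely presented algebra, with one generator for the grading
([superalgebra_rel]).  For representations [x] and [y] there is a complex of
matrix spaces with differentials [D0 x y] and [D1 x y], whose kernel in degree 0
consists of the intertwiners.  When [x] is rigid the complex is exact in degree
1 at [(x, x)]; exactness and the ranks persist at all [(x, y)] where a certain
polynomial [h (x, y)] does not vanish.  There the intertwiner [1] of [x] deforms
to an intertwiner from [x] to [y], given by a polynomial formula, and a further
determinant makes it invertible ([kernel_neq0]).  The polynomial satisfies
[h (x, x) = 1], and [h (x, y) = 0] whenever [x] is rigid and [y] is not isomorphic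
to [x].  Being a polynomial, it is a finite sum of products [a (x) b (y)], so the
matrix of its values at pairwise nonisomorphic rigid representations, an
identity matrix, has bounded rank.  This bounds the number of classes
([finitely_many_rigid]); it replaces the usual argument that rigid orbits are
open in the variety of representations.
*)

(** * Finite-rank kernels *)

Section FiniteRank.
Variables (k : fieldType) (X : Type).
Implicit Types (h : X -> X -> k).

Definition finite_rank h :=
  exists s (a b : 'I_s -> X -> k), forall x y, h x y = \sum_i a i x * b i y.

Lemma finite_rank_ext h h' : (forall x y, h x y = h' x y) ->
  finite_rank h -> finite_rank h'.
Proof. by move=> E [s [a [b H]]]; exists s, a, b => x y; rewrite -E. Qed.

Lemma finite_rank_mul1 (u v : X -> k) : finite_rank (fun x y => u x * v y).
Proof. by exists 1%N, (fun=> u), (fun=> v) => x y; rewrite big_ord1. Qed.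

Lemma finite_rankl (u : X -> k) : finite_rank (fun x _ => u x).
Proof.
by apply: finite_rank_ext (finite_rank_mul1 u (fun=> 1)) => x y; rewrite mulr1.
Qed.

Lemma finite_rankr (v : X -> k) : finite_rank (fun _ y => v y).
Proof.
by apply: finite_rank_ext (finite_rank_mul1 (fun=> 1) v) => x y; rewrite mul1r.
Qed.

Lemma finite_rankD h h' : finite_rank h -> finite_rank h' ->
  finite_rank (fun x y => h x y + h' x y).
Proof.
move=> [s [a [b H]]] [s' [a' [b' H']]]; exists (s + s')%N,
  (fun i => match split i with inl j => a j | inr j => a' j end),
  (fun i => match split i with inl j => b j | inr j => b' j end) => x y.
rewrite big_split_ord H H' /=; congr (_ + _); apply: eq_bigr => i _.
  by rewrite (unsplitK (inl i)).
by rewrite (unsplitK (inr i)).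
Qed.

Lemma finite_rankM h h' : finite_rank h -> finite_rank h' ->
  finite_rank (fun x y => h x y * h' x y).
Proof.
move=> [s [a [b H]]] [s' [a' [b' H']]].
exists #|{: 'I_s * 'I_s'}|,
  (fun i x => a (enum_val i).1 x * a' (enum_val i).2 x),
  (fun i y => b (enum_val i).1 y * b' (enum_val i).2 y) => x y.
rewrite H H' big_distrl /=.
transitivity (\sum_(p : 'I_s * 'I_s')
    (a p.1 x * b p.1 y) * (a' p.2 x * b' p.2 y)).
  rewrite -(pair_bigA _ (fun i j => a i x * b i y * (a' j x * b' j y))) /=.
  by apply: eq_bigr => i _; rewrite big_distrr.
rewrite (reindex (@enum_val _ _ : 'I_#|{: 'I_s * 'I_s'}| -> 'I_s * 'I_s')) /=.
  by apply: eq_bigr => i _; rewrite mulrACA.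
by apply: onW_bij; exact: enum_val_bij.
Qed.

Lemma finite_rank_const c : finite_rank (fun _ _ => c).
Proof. exact: (finite_rankl (fun=> c)). Qed.

Lemma finite_rankN h : finite_rank h -> finite_rank (fun x y => - h x y).
Proof.
move=> /(finite_rankM (finite_rank_const (-1))); apply: finite_rank_ext => x y.
by rewrite mulN1r.
Qed.

Lemma finite_rank_sum (I : Type) (r : seq I) (P : pred I) (h : I -> X -> X -> k) :
  (forall i, finite_rank (h i)) ->
  finite_rank (fun x y => \sum_(i <- r | P i) h i x y).
Proof.
move=> H; elim: r => [|i r IH].
  by apply: finite_rank_ext (finite_rank_const 0) => x y; rewrite big_nil.
case Pi: (P i).
  by apply: finite_rank_ext (finite_rankD (H i) IH) => x y; rewrite big_cons Pi.
by apply: finite_rank_ext IH => x y; rewrite big_cons Pi.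
Qed.

Lemma finite_rank_prod (I : Type) (r : seq I) (h : I -> X -> X -> k) :
  (forall i, finite_rank (h i)) -> finite_rank (fun x y => \prod_(i <- r) h i x y).
Proof.
move=> H; elim: r => [|i r IH].
  by apply: finite_rank_ext (finite_rank_const 1) => x y; rewrite big_nil.
by apply: finite_rank_ext (finite_rankM (H i) IH) => x y; rewrite big_cons.
Qed.

Definition finite_rank_mx m n (A : X -> X -> 'M[k]_(m, n)) :=
  forall i j, finite_rank (fun x y => A x y i j).

Lemma finite_rank_mxl m n (u : X -> 'M[k]_(m, n)) : finite_rank_mx (fun x _ => u x).
Proof. by move=> i j; apply: finite_rankl. Qed.

Lemma finite_rank_mxr m n (u : X -> 'M[k]_(m, n)) : finite_rank_mx (fun _ y => u y).
Proof. by move=> i j; apply: finite_rankr. Qed.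

Lemma finite_rank_mxD m n (A B : X -> X -> 'M[k]_(m, n)) :
  finite_rank_mx A -> finite_rank_mx B -> finite_rank_mx (fun x y => A x y + B x y).
Proof.
move=> fA fB i j; apply: finite_rank_ext (finite_rankD (fA i j) (fB i j)) => x y.
by rewrite mxE.
Qed.

Lemma finite_rank_mxN m n (A : X -> X -> 'M[k]_(m, n)) :
  finite_rank_mx A -> finite_rank_mx (fun x y => - A x y).
Proof.
by move=> fA i j; apply: finite_rank_ext (finite_rankN (fA i j)) => x y; rewrite mxE.
Qed.

Lemma finite_rank_mxM m n p (A : X -> X -> 'M[k]_(m, n)) (B : X -> X -> 'M[k]_(n, p)) :
  finite_rank_mx A -> finite_rank_mx B -> finite_rank_mx (fun x y => A x y *m B x y).
Proof.
move=> fA fB i j.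
apply: finite_rank_ext
  (finite_rank_sum _ _ (fun l => finite_rankM (fA i l) (fB l j))) => x y.
by rewrite mxE.
Qed.

Lemma finite_rank_det n (A : X -> X -> 'M[k]_n) :
  finite_rank_mx A -> finite_rank (fun x y => \det (A x y)).
Proof.
move=> fA; apply: finite_rank_sum => s; apply: finite_rankM.
  exact: finite_rank_const.
by apply: finite_rank_prod => i; apply: fA.
Qed.

Lemma finite_rank_adj n (A : X -> X -> 'M[k]_n) :
  finite_rank_mx A -> finite_rank_mx (fun x y => \adj (A x y)).
Proof.
move=> fA i j; apply: (@finite_rank_ext (fun x y => (-1) ^+ (j + i) *
    \det (row' j (col' i (A x y))))) => [x y|]; first by rewrite !mxE.
apply: finite_rankM; first exact: finite_rank_const.
apply: finite_rank_det => p q.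
by apply: finite_rank_ext (fA (lift j p) (lift i q)) => x y; rewrite !mxE.
Qed.

Lemma finite_rank_vec_mx m n (A : X -> X -> 'rV[k]_(m * n)) :
  finite_rank_mx A -> finite_rank_mx (fun x y => vec_mx (A x y)).
Proof.
move=> fA i j; apply: finite_rank_ext (fA 0 (mxvec_index i j)) => x y.
by rewrite mxE.
Qed.

Lemma finite_rank_mxvec m n (A : X -> X -> 'M[k]_(m, n)) :
  finite_rank_mx A -> finite_rank_mx (fun x y => mxvec (A x y)).
Proof.
move=> fA i l; case/mxvec_indexP: l => p q.
by apply: finite_rank_ext (fA p q) => x y; rewrite ord1 mxvecE.
Qed.

(** The matrix [h (x i) (x j)] factors through the rank of [h], and it is
    triangular with nonzero diagonal, hence invertible. *)
Lemma finite_rank_bound h : finite_rank h ->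
  exists s, forall m (x : 'I_m -> X),
    (forall i, h (x i) (x i) != 0) ->
    (forall i j : 'I_m, (i < j)%N -> h (x i) (x j) = 0) -> (m <= s)%N.
Proof.
move=> [s [a [b H]]]; exists s => m x hd ht.
pose A : 'M[k]_(m, s) := \matrix_(i, l) a l (x i).
pose B : 'M[k]_(s, m) := \matrix_(l, j) b l (x j).
have ABE i j : (A *m B) i j = h (x i) (x j).
  by rewrite mxE H; apply: eq_bigr => l _; rewrite !mxE.
have trigAB : is_trig_mx (A *m B).
  by apply/is_trig_mxP => i j ij; rewrite ABE ht.
have unitAB : A *m B \in unitmx.
  rewrite unitmxE det_trig // unitfE.
  by apply/prodf_neq0 => i _; rewrite ABE.
by rewrite -(mxrank_unit unitAB) (leq_trans (mulmx_max_rank A B)).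
Qed.

(** Any list of good elements no one of which is related to an earlier one is
    bounded in length by the rank of [h], so a maximal such list exists and meets
    every class. *)
Lemma finitely_many_classes (good : X -> Prop) (R : X -> X -> Prop) h :
  finite_rank h -> (forall x, good x -> h x x != 0) ->
  (forall x y, good x -> good y -> h x y != 0 -> R y x) ->
  exists N (L : 'I_N -> X), forall y, good y -> exists i, R y (L i).
Proof.
move=> /finite_rank_bound[s hs] hd hR.
(* As long as a list of representatives is incomplete it can be extended. *)
have greedy m : (exists N (L : 'I_N -> X), forall y, good y -> exists i, R y (L i)) \/
    exists x : 'I_m -> X, (forall i, good (x i)) /\
      forall i j : 'I_m, (i < j)%N -> ~ R (x j) (x i).
  elim: m => [|m [cov|[x [gx nR]]]].
  - right; exists (fun i : 'I_0 => False_rect X (notF (ltn_ord i))).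
    by split=> [[]|[]].
  - by left.
  have [cov|] := classic (forall y, good y -> exists i, R y (x i)).
    by left; exists m, x.
  move=> ncov; have [y H] := not_all_ex_not _ _ ncov; right.
  have [gy Ry] := imply_to_and _ _ H.
  exists (fun i => oapp x y (unlift ord_max i)); split=> [i|i j].
    by case: unliftP => [i' _|_] /=.
  case: (unliftP _ j) => [j' ->|->]; case: (unliftP _ i) => [i' ->|->].
  + by rewrite !lift_max; apply: nR.
  + by rewrite lift_max ltnNge ltnW.
  + by move=> _ Ri; apply: Ry; exists i'.
  + by rewrite ltnn.
case: (greedy s.+1) => // -[x [gx nR]].
suff : (s.+1 <= s)%N by rewrite ltnn.
apply: (hs _ x) => [i|i j ij]; first exact/hd/gx.
by apply/eqP/idPn => /(hR _ _ (gx _) (gx _)); apply: nR.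
Qed.

End FiniteRank.

(** * Rigid representations of finitely presented algebras *)

(** Syntax for the relations of an algebra presented by generators [I]. *)
Inductive ncpoly (k : Type) (I : Type) :=
  | NVar of I
  | NConst of k
  | NAdd of ncpoly k I & ncpoly k I
  | NMul of ncpoly k I & ncpoly k I.
Arguments NVar {k I}.
Arguments NConst {k I}.

Section Presentation.
Variables (k : fieldType) (I J : finType) (rel : J -> ncpoly k I) (n : nat).
Implicit Types (x y f : I -> 'M[k]_n) (p : ncpoly k I) (T : 'M[k]_n).

Fixpoint nceval x p : 'M[k]_n :=
  match p with
  | NVar i => x i
  | NConst c => c%:M
  | NAdd p q => nceval x p + nceval x q
  | NMul p q => nceval x p *m nceval x q
  end.

(** The off-diagonal block of the value of [p] at the block triangular matrices
    with diagonal blocks [y], [x] and off-diagonal block [f]: its vanishing on the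
    relations means that [f] defines an extension of [x] by [y]. *)
Fixpoint ncder x y f p : 'M[k]_n :=
  match p with
  | NVar i => f i
  | NConst c => 0
  | NAdd p q => ncder x y f p + ncder x y f q
  | NMul p q => ncder x y f p *m nceval x q + nceval y p *m ncder x y f q
  end.

Definition is_rep x := forall j, nceval x (rel j) = 0.

(** For a representation [x] this is [Ext^1(x, x) = 0]. *)
Definition rigid x := forall f, (forall j, ncder x x f (rel j) = 0) ->
  exists T, forall i, f i = x i *m T - T *m x i.

Lemma ncder_inner x y T p :
  ncder x y (fun i => y i *m T - T *m x i) p = nceval y p *m T - T *m nceval x p.
Proof.
elim: p => [i|c|p IHp q IHq|p IHp q IHq] //=.
- by rewrite scalar_mxC subrr.
- by rewrite IHp IHq mulmxDl mulmxDr opprD addrACA.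
- rewrite IHp IHq mulmxBl mulmxBr -!mulmxA addrC addrA.
  by rewrite addrNK.
Qed.

Lemma ncder_linear x y c f f' p :
  ncder x y (fun i => c *: f i + f' i) p = c *: ncder x y f p + ncder x y f' p.
Proof.
elim: p => [i|a|p IHp q IHq|p IHp q IHq] //=.
- by rewrite scaler0 addr0.
- by rewrite IHp IHq scalerDr addrACA.
- by rewrite IHp IHq mulmxDl mulmxDr -!scalemxAl -!scalemxAr scalerDr addrACA.
Qed.

Lemma eq_ncder x y f f' p : f =1 f' -> ncder x y f p = ncder x y f' p.
Proof.
by move=> E; elim: p => [i|a|p IHp q IHq|p IHp q IHq] //=; rewrite ?IHp ?IHq.
Qed.

End Presentation.

Section RigidRepresentations.
Variables (k : fieldType) (I J : finType) (rel : J -> ncpoly k I) (n : nat).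
Implicit Types (x y : I -> 'M[k]_n) (T : 'M[k]_n).

Let c0 := (n * n)%N.
Let c1 := (#|I| * (n * n))%N.
Let c2 := (#|J| * (n * n))%N.

(* Families of matrices indexed by a finite type, stored as the rows of one
   matrix. *)
Let pack (K : finType) (f : K -> 'M[k]_n) : 'M[k]_(#|K|, n * n) :=
  \matrix_i mxvec (f (enum_val i)).
Let unpack (K : finType) (A : 'M[k]_(#|K|, n * n)) (i : K) : 'M[k]_n :=
  vec_mx (row (enum_rank i) A).

Lemma packK (K : finType) (f : K -> 'M[k]_n) : unpack (pack f) =1 f.
Proof. by move=> i; rewrite /unpack rowK mxvecK enum_rankK. Qed.

Lemma unpackK (K : finType) (A : 'M[k]_(#|K|, n * n)) : pack (unpack A) = A.
Proof. by apply/row_matrixP => i; rewrite rowK vec_mxK enum_valK. Qed.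

Lemma unpack_linear (K : finType) (i : K) : linear (fun A => @unpack K A i).
Proof. by move=> c A B; rewrite /unpack !linearP. Qed.

Let d0 x y T := pack (fun i => y i *m T - T *m x i).
Let d1 x y A := pack (fun j => ncder x y (@unpack I A) (rel j)).

Fact d0_linear x y : linear (d0 x y).
Proof.
move=> c S T; apply/row_matrixP => i; rewrite linearP /= !rowK -linearP /=.
congr mxvec.
rewrite mulmxDr mulmxDl -scalemxAr -scalemxAl opprD addrACA.
by rewrite scalerBr.
Qed.

Fact d1_linear x y : linear (d1 x y).
Proof.
move=> c A B; apply/row_matrixP => i; rewrite linearP /= !rowK -linearP /=.
by rewrite -ncder_linear; congr mxvec; apply: eq_ncder => j; apply: unpack_linear.
Qed.

HB.instance Definition _ x y := GRing.isLinear.Build k _ _ _ (d0 x y) (d0_linear x y).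
HB.instance Definition _ x y := GRing.isLinear.Build k _ _ _ (d1 x y) (d1_linear x y).

Let D0 x y : 'M[k]_(c0, c1) := lin_mx (d0 x y).
Let D1 x y : 'M[k]_(c1, c2) := lin_mx (d1 x y).

Lemma d0P x y T : reflect (forall i, y i *m T = T *m x i) (mxvec T *m D0 x y == 0).
Proof.
rewrite mul_vec_lin mxvec_eq0; apply: (iffP eqP) => [d0T i|H].
  apply/eqP; rewrite -subr_eq0; apply/eqP.
  rewrite -(packK (fun i => y i *m T - T *m x i) i) -/(d0 x y T) d0T.
  by rewrite /unpack !linear0.
by apply/row_matrixP => i; rewrite rowK H subrr !linear0.
Qed.

Lemma D01 x y : is_rep rel x -> is_rep rel y -> D0 x y *m D1 x y = 0.
Proof.
move=> rx ry; apply/row_matrixP => i; rewrite row0 rowE mulmxA.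
rewrite -[delta_mx 0 i]vec_mxK !mul_vec_lin; set T := vec_mx _ => /=.
suff -> : d1 x y (d0 x y T) = 0 by rewrite linear0.
apply/row_matrixP => j; rewrite rowK row0.
rewrite (eq_ncder _ _ _ (packK (fun i => y i *m T - T *m x i))).
by rewrite ncder_inner rx ry mul0mx mulmx0 subrr linear0.
Qed.

(** Rigidity is exactness of the complex at its middle term. *)
Lemma rigid_rank x : rigid rel x -> (c1 <= \rank (D0 x x) + \rank (D1 x x))%N.
Proof.
move=> rx; rewrite addnC -leq_subLR -mxrank_ker.
apply/mxrankS/rV_subP => v /sub_kermxP vD.
have d1v : d1 x x (vec_mx v) = 0.
  by apply/eqP; rewrite -mxvec_eq0 -mul_vec_lin vec_mxK vD.
have [|T HT] := rx (unpack (vec_mx v)).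
  by move=> j; rewrite -(packK (fun j => ncder _ _ _ (rel j)) j) -/(d1 x x _) d1v /unpack !linear0.
apply/submxP; exists (mxvec T); rewrite mul_vec_lin -[v in LHS]vec_mxK.
congr mxvec; rewrite -[vec_mx v]unpackK; apply/row_matrixP => i.
by rewrite !rowK HT.
Qed.

(** The first two terms project onto the left kernel of [D x x], so the matrix
    becomes the identity at [y = x]. *)
Definition comparison m p (D : (I -> 'M[k]_n) -> (I -> 'M[k]_n) -> 'M[k]_(m, p)) x y :=
  1%:M - D x x *m pinvmx (D x x) + D x y *m pinvmx (D x x).

Lemma comparison_diag m p D x : @comparison m p D x x = 1%:M.
Proof. by rewrite /comparison subrK. Qed.

(** Lower semicontinuity of the rank, witnessed by the determinant of the
    comparison matrix: an invertible matrix cannot be the sum of a projection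
    onto the kernel of [D x x] and a matrix of smaller rank than [D x x]. *)
Lemma comparison_rank m p (D : _ -> _ -> 'M[k]_(m, p)) x y :
  comparison D x y \in unitmx -> (\rank (D x x) <= \rank (D x y))%N.
Proof.
move=> /mxrank_unit Q1.
set P := pinvmx (D x x) in Q1 *; set E := 1%:M - D x x *m P.
have ED : (E <= kermx (D x x))%MS.
  by apply/sub_kermxP; rewrite mulmxBl mul1mx mulmxKpV ?subrr ?submx_refl.
have := leq_trans (eq_leq (esym Q1)) (mxrank_add _ _).
move/leq_trans/(_ (leq_add (mxrankS ED) (mxrankM_maxl _ _))).
by rewrite mxrank_ker -leq_subLR subKn ?rank_leq_row // => ->.
Qed.

(* The preimage of the identity under the comparison matrix, with the inverse
   replaced by the adjugate to stay polynomial in [y]. *)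
Let intertwiner x y : 'M[k]_n :=
  vec_mx (mxvec 1%:M *m \adj (comparison D0 x y)).

Let kernel x y : k :=
  \det (comparison D0 x y) * \det (comparison D1 x y) * \det (intertwiner x y).

Lemma kernel_diag x : kernel x x = 1.
Proof.
rewrite /kernel /intertwiner !comparison_diag !det1 adj1.
by rewrite mulmx1 mxvecK det1 !mul1r.
Qed.

(** Nonvanishing of the kernel at [(x, y)] forces the complex at [(x, y)] to
    have the same ranks as the exact complex at [(x, x)].  The comparison matrix
    then maps the left kernel of [D0 x y] injectively, hence for dimension
    reasons onto, that of [D0 x x], which contains the identity; its preimage is
    an intertwiner up to the determinant. *)
Lemma kernel_neq0 x y : is_rep rel x -> is_rep rel y -> rigid rel x ->
  kernel x y != 0 ->
  exists2 T, T \in unitmx & forall i, y i *m T = T *m x i.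
Proof.
move=> rx ry gx; rewrite /kernel !mulf_eq0 !negb_or => /andP[/andP[q0 q1] dT].
exists (intertwiner x y); first by rewrite unitmxE unitfE.
apply/d0P; rewrite vec_mxK.
set Q := comparison D0 x y in q0 *; set P := pinvmx (D0 x x).
have uQ : Q \in unitmx by rewrite unitmxE unitfE.
have r1 : (\rank (D1 x x) <= \rank (D1 x y))%N.
  by apply: comparison_rank; rewrite unitmxE unitfE.
have r01 : (\rank (D0 x y) + \rank (D1 x y) <= c1)%N.
  by apply: mulmx0_rank_max; apply: D01.
have r0 : (\rank (D0 x y) <= \rank (D0 x x))%N.
  rewrite -(leq_add2r (\rank (D1 x x))) (leq_trans _ (rigid_rank gx)) //.
  exact: leq_trans (leq_add (leqnn _) r1) r01.
have KQ : (kermx (D0 x y) *m Q <= kermx (D0 x x))%MS.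
  apply/sub_kermxP; rewrite /Q /comparison mulmxDr [_ *m (D0 x y *m _)]mulmxA.
  by rewrite mulmx_ker mul0mx addr0 -mulmxA mulmxBl mul1mx mulmxKpV ?subrr ?mulmx0.
have QK : (kermx (D0 x x) <= kermx (D0 x y) *m Q)%MS.
  have := mxrank_leqif_sup KQ; move=> /leqifP; case: ifP => // _.
  by rewrite mxrankMfree ?row_free_unit // !mxrank_ker ltnNge leq_sub2l.
have eK : (mxvec 1%:M <= kermx (D0 x x))%MS.
  apply/sub_kermxP/eqP/(d0P x x 1%:M) => i.
  by rewrite mulmx1 mul1mx.
have /submxP[u ->] := submx_trans eK QK.
rewrite -mulmxA -[u *m _ *m _]mulmxA -[_ *m Q *m _]mulmxA [Q *m _]mulmxA mul_mx_adj mul_scalar_mx.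
by rewrite -scalemxAr mulmx_ker scaler0 mulmx0.
Qed.

Lemma finite_rank_kernel : finite_rank kernel.
Proof.
have fact m p (D : _ -> _ -> 'M[k]_(m, p)) :
    finite_rank_mx D -> finite_rank_mx (comparison D).
  move=> fD; apply: finite_rank_mxD; first exact: finite_rank_mxl.
  exact: finite_rank_mxM fD (finite_rank_mxl _).
have fpack (K : finType) (f : _ -> _ -> K -> 'M[k]_n) :
    (forall i, finite_rank_mx (fun x y => f x y i)) ->
    finite_rank_mx (fun x y => pack (f x y)).
  move=> ff i j.
  apply: finite_rank_ext (finite_rank_mxvec (ff (enum_val i)) 0 j) => x y.
  by rewrite mxE.
have flin p q r s (f : _ -> _ -> 'M[k]_(p, q) -> 'M[k]_(r, s)) :
    (forall A, finite_rank_mx (fun x y => f x y A)) ->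
    finite_rank_mx (fun x y => lin_mx (f x y)).
  move=> ff i j; apply: finite_rank_ext
    (finite_rank_mxvec (ff (vec_mx (delta_mx 0 i))) 0 j) => x y.
  by rewrite /lin_mx /lin1_mx mxE.
have fD0 : finite_rank_mx D0.
  apply: flin => T; apply: fpack => i; apply: finite_rank_mxD.
    exact: finite_rank_mxr (fun y => y i *m T).
  by apply: finite_rank_mxN; exact: finite_rank_mxl (fun x => T *m x i).
have fD1 : finite_rank_mx D1.
  apply: flin => A; apply: fpack => j.
  elim: (rel j) => [i|c|p IHp q IHq|p IHp q IHq] /=.
  - exact: finite_rank_mxl (fun=> unpack A i).
  - exact: finite_rank_mxl (fun=> 0).
  - exact: finite_rank_mxD.
  - apply: finite_rank_mxD; apply: finite_rank_mxM => //.
      exact: finite_rank_mxl (fun x => nceval x q).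
    exact: finite_rank_mxr (fun y => nceval y p).
apply: finite_rankM; first by apply: finite_rankM; apply: finite_rank_det; apply: fact.
apply/finite_rank_det/finite_rank_vec_mx/finite_rank_mxM.
  exact: finite_rank_mxl (fun=> mxvec 1%:M).
exact/finite_rank_adj/fact.
Qed.

End RigidRepresentations.

(** The statement allows extra structure [S] on representations, because the
    representations of interest come from modules. *)
Theorem finitely_many_rigid (k : fieldType) (I J : finType)
    (rel : J -> ncpoly k I) (n : nat) (S : Type) (mx : S -> I -> 'M[k]_n)
    (good : S -> Prop) (R : S -> S -> Prop) :
  (forall s, good s -> is_rep rel (mx s) /\ rigid rel (mx s)) ->
  (forall s t T, good s -> good t -> T \in unitmx ->
     (forall i, mx t i *m T = T *m mx s i) -> R t s) ->
  exists N (L : 'I_N -> S), forall t, good t -> exists i, R t (L i).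
Proof.
move=> rg RT; have [s [a [b H]]] := finite_rank_kernel rel n.
apply: (@finitely_many_classes k S good R
  (fun s t => \sum_i a i (mx s) * b i (mx t))).
- by exists s, (fun i s => a i (mx s)), (fun i s => b i (mx s)).
- by move=> x gx; rewrite -H kernel_diag oner_eq0.
move=> x y gx gy; rewrite -H.
have [[rx dx] [ry _]] := (rg x gx, rg y gy).
by case/(kernel_neq0 rx ry dx) => T uT HT; apply: RT HT.
Qed.

(** * Engel's theorem *)

(** The iterates of [h] on a product obey the binomial formula, so nilpotency of
    [f] and [g] at the factors gives that of [h].  This serves both for
    commutators with nilpotent matrices and for sums of generalized
    eigenvalues. *)
Lemma iter_leibniz (E V Z : zmodType) (b : E -> V -> Z)
    (f : E -> E) (g : V -> V) (h : Z -> Z) :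
  (forall v, b 0 v = 0) -> (forall e, b e 0 = 0) -> (h 0 = 0) ->
  {morph h : x y / x + y} -> (forall e v, h (b e v) = b (f e) v + b e (g v)) ->
  forall p q e v, iter p f e = 0 -> iter q g v = 0 -> iter (p + q) h (b e v) = 0.
Proof.
move=> b0l b0r h0 hD hb.
have it0 m : iter m h 0 = 0 by elim: m => //= m ->.
have itD m : {morph iter m h : x y / x + y}.
  by elim: m => // m IH x y; rewrite !iterSr hD IH.
elim=> [|p IHp] q e v fe; first by rewrite [e]fe b0l it0.
elim: q v => [|q IHq] v gv; first by rewrite [v]gv b0r it0.
rewrite iterSr in fe; rewrite iterSr in gv.
rewrite addSn iterSr hb itD IHp ?iterSr // add0r -addSnnS.
by apply: IHq.
Qed.

Section Engel.
Variables (k : fieldType) (n : nat).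
Implicit Types (T K : {vspace 'M[k]_n}) (A B : 'M[k]_n).

Definition mxcomm A B := A *m B - B *m A.

Definition lie_closed T := {in T &, forall A B, mxcomm A B \in T}.

Lemma mxcomm_linearr A : linear (mxcomm A).
Proof.
move=> c B B'; rewrite /mxcomm mulmxDr mulmxDl -scalemxAr -scalemxAl.
by rewrite scalerBr opprD addrACA.
Qed.

Lemma mxcomm_linearl B : linear (mxcomm^~ B).
Proof.
move=> c A A'; rewrite /mxcomm mulmxDr mulmxDl -scalemxAr -scalemxAl.
by rewrite scalerBr opprD addrACA.
Qed.

Lemma mxcommN A B : mxcomm A B = - mxcomm B A.
Proof. by rewrite /mxcomm opprB. Qed.

Lemma mxcomm_jacobi A B C : mxcomm (mxcomm A B) C = mxcomm A (mxcomm B C) - mxcomm B (mxcomm A C).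
Proof.
rewrite /mxcomm !mulmxBl !mulmxBr !mulmxA !opprB !addrA.
rewrite [RHS](ACl (1*8*3*6*(2*5)*(4*7))) /=.
by rewrite !addNr !addr0.
Qed.

(* Commutators of [K + <[y]>] stay in [K] because [mxcomm y y = 0]. *)
Lemma mxcomm_add_line K y A B a b : lie_closed K ->
  {in K, forall A, mxcomm A y \in K} -> A \in K -> B \in K ->
  mxcomm (A + a *: y) (B + b *: y) \in K.
Proof.
move=> cK Ky AK BK.
rewrite ![_ + _ *: y]addrC mxcomm_linearr.
have /= E C := mxcomm_linearl C a y A; rewrite !E [mxcomm y y]subrr scaler0 add0r.
rewrite [mxcomm y B]mxcommN.
move: (cK A B AK BK) (Ky A AK) (Ky B BK).
move: (mxcomm A B) (mxcomm A y) (mxcomm B y) => C D F hC hD hF.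
by rewrite !(rpredD, rpredZ, rpredN).
Qed.

(** Engel's conclusion relative to a pair of invariant subspaces: it applies to
    the action of a subalgebra [K] on [T] modulo [K] without forming
    quotients. *)
Definition engel_at T := forall (V : vectType k) (r : 'M[k]_n -> V -> V),
  (forall A, linear (r A)) -> (forall v, linear (r^~ v)) ->
  {in T &, forall A B v, r (mxcomm A B) v = r A (r B v) - r B (r A v)} ->
  {in T, forall A v, exists m, iter m (r A) v = 0} ->
  forall U W : {vspace V},
    {in T, forall A, {in U, forall u, r A u \in U}} ->
    {in T, forall A, {in W, forall w, r A w \in W}} ->
    ~~ (W <= U)%VS ->
  exists w, [/\ w \in W, w \notin U & {in T, forall A, r A w \in U}].

Lemma mxcomm_nilpotent A m B : A ^+ m = 0 -> iter (m + m) (mxcomm A) B = 0.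
Proof.
move=> Am; have ml (p : nat) (C : 'M[k]_n) : iter p (mulmx A) C = A ^+ p *m C.
  elim: p => [|p IH]; first by rewrite expr0 mul1mx.
  by rewrite iterS IH mulmxA exprS.
have mr (p : nat) (C : 'M[k]_n) : iter p (fun D => - (D *m A)) C = (-1) ^+ p *: (C *m A ^+ p).
  elim: p => [|p IH]; first by rewrite !expr0 mulmx1 scale1r.
  rewrite iterS IH -scalemxAl -mulmxA [A ^+ p.+1]exprSr.
  by rewrite exprS -scalerA scaleN1r.
rewrite -[B]mul1mx.
apply: (@iter_leibniz _ _ _ mulmx (mulmx A) (fun D => - (D *m A))).
- exact: mul0mx.
- exact: mulmx0.
- by rewrite /mxcomm mulmx0 mul0mx subrr.
- by move=> C D; have := mxcomm_linearr A 1 C D; rewrite !scale1r.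
- by move=> C D; rewrite /mxcomm mulmxN !mulmxA.
- by rewrite ml Am mul0mx.
- by rewrite mr Am mulmx0 scaler0.
Qed.

(** A proper subalgebra acting nilpotently on the algebra by commutators
    normalizes a line outside itself, so it can be enlarged one dimension at a
    time. *)
Lemma codim1_ideal T : lie_closed T -> {in T, forall A, exists m, A ^+ m = 0} ->
  (forall K, lie_closed K -> (K <= T)%VS -> (\dim K < \dim T)%N -> engel_at K) ->
  (0 < \dim T)%N ->
  exists K y, [/\ lie_closed K, (K <= T)%VS, y \in T, y \notin K &
    {in K, forall A, mxcomm A y \in K} /\ T = (K + <[y]>)%VS].
Proof.
move=> cT nT eT T0.
suff grow m K : lie_closed K -> (K <= T)%VS -> (\dim K < \dim T)%N ->
    (\dim T <= \dim K + m)%N -> exists K y, [/\ lie_closed K, (K <= T)%VS, y \in T, y \notin K &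
    {in K, forall A, mxcomm A y \in K} /\ T = (K + <[y]>)%VS].
  apply: (grow (\dim T) 0%VS); rewrite ?dimv0 ?sub0v //.
  by move=> A B; rewrite !memv0 => /eqP-> /eqP->; rewrite /mxcomm !mulmx0 subrr.
elim: m K => [|m IH] K cK KT dK; first by rewrite addn0 leqNgt dK.
move=> dT; have KTv := subvP KT.
have [|||||y [yT yK Ky]] := eT K cK KT dK _ mxcomm mxcomm_linearr mxcomm_linearl _ _ K T.
- by move=> A B _ _ C; apply: mxcomm_jacobi.
- by move=> A /KTv/nT[p Ap] B; exists (p + p)%N; apply: mxcomm_nilpotent.
- by move=> A AK B; apply: cK.
- by move=> A /KTv AT B; apply: cT.
- by apply: contraL dK => /dimvS; rewrite -leqNgt.
pose K' := (K + <[y]>)%VS.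
have K'T : (K' <= T)%VS by rewrite subv_add KT -memvE.
have cK' : lie_closed K'.
  move=> _ _ /memv_addP[A AK [_ /vlineP[a ->] ->]] /memv_addP[B BK [_ /vlineP[b ->] ->]].
  apply: (subvP (addvSl K <[y]>)).
  exact: mxcomm_add_line.
have dK' : (\dim K < \dim K')%N.
  rewrite (ltn_leqif (dimv_leqif_sup (addvSl _ _))).
  by apply: contra yK => /subvP; apply; rewrite (subvP (addvSr _ _)) ?memv_line.
have [dT'|dT'] := ltnP (\dim K') (\dim T).
  apply: (IH K') => //; apply: leq_trans dT _.
  by rewrite addnS -addSn leq_add2r.
exists K, y; split=> //; split=> //.
by apply/eqP; rewrite eq_sym eqEdim K'T.
Qed.

(** A vector killed by [K] modulo [U] stays so under a normalizing element [y],
    and its last iterate under the nilpotent [y] that lies outside [U] is killed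
    by [K + <[y]>]. *)
Theorem engel T : lie_closed T -> {in T, forall A, exists m, A ^+ m = 0} -> engel_at T.
Proof.
move: {2}(\dim T) (leqnn (\dim T)) => d.
elim: d T => [|d IH] T dT cT nT V r rl rr rT nr U W TU TW WU.
  move: dT; rewrite leqn0 dimv_eq0 => /eqP T0.
  have [w wW wU] := subvPn WU; exists w; split=> // A.
  rewrite T0 memv0 => /eqP->.
  have := rr w (-1) 0 0; rewrite scaler0 addr0 scaleN1r addNr => ->.
  exact: mem0v.
have [T0|Tn0] := posnP (\dim T); first by apply: (IH T); rewrite ?T0.
have eK K : lie_closed K -> (K <= T)%VS -> (\dim K < \dim T)%N -> engel_at K.
  move=> cK /subvP KT dK; apply: (IH K) => //; last by move=> A /KT/nT.
  by rewrite -ltnS (leq_trans dK).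
have [K [y [cK KT yT yK [Ky TE]]]] := codim1_ideal cT nT eK Tn0.
have KTv := subvP KT.
have dK : (\dim K < \dim T)%N.
  by rewrite (ltn_leqif (dimv_leqif_sup KT)); apply: contra yK => /subvP; apply.
have [|||||w [wW wU Kw]] := eK K cK KT dK V r rl rr _ _ U W.
- by move=> A B /KTv AT /KTv BT; apply: rT.
- by move=> A /KTv/nr.
- by move=> A /KTv/TU.
- by move=> A /KTv/TW.
- exact: WU.
have yw i : iter i (r y) w \in W /\ {in K, forall A, r A (iter i (r y) w) \in U}.
  elim: i => [|i [iW iU]] //=; split=> [|A AK]; first exact: TW.
  have : r (mxcomm A y) (iter i (r y) w) \in U by exact: (iU _ (Ky A AK)).
  rewrite (rT A y (KTv A AK) yT) => h; rewrite -[r A _](subrK (r y (r A (iter i (r y) w)))).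
  by rewrite rpredD //; exact: (TU y yT _ (iU A AK)).
have exm : exists m, iter m (r y) w \in U.
  by have [m E] := nr y yT w; exists m; rewrite E mem0v.
case: (ex_minnP exm) => -[|m] mU minm; first by case/negP: wU.
exists (iter m (r y) w); split; first exact: (yw m).1.
  by apply/negP => /minm; rewrite ltnn.
move=> A; rewrite TE => /memv_addP[B BK [_ /vlineP[c ->] ->]].
have /= E := rr (iter m (r y) w) c y B; rewrite addrC E.
rewrite memvD ?memvZ //; exact: (yw m).2.
Qed.

(** The subalgebra of codimension one from [codim1_ideal] contains all
    commutators. *)
Lemma nilpotent_perfect0 T : lie_closed T -> {in T, forall A, exists m, A ^+ m = 0} ->
  (forall K : {vspace 'M[k]_n}, {in T &, forall A B, mxcomm A B \in K} -> (T <= K)%VS) ->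
  T = 0%VS.
Proof.
move=> cT nT pT; apply/eqP; rewrite -dimv_eq0 -leqn0 leqNgt; apply/negP => T0.
have [|K [y [cK KT yT yK [Ky TE]]]] := codim1_ideal cT nT _ T0.
  move=> K cK /subvP KT _; apply: engel => // A /KT; exact: nT.
case/negP: yK; apply: (subvP (pT K _)) => // A B.
rewrite TE.
move=> /memv_addP[A' AK [_ /vlineP[a ->] ->]] /memv_addP[B' BK [_ /vlineP[b ->] ->]].
exact: mxcomm_add_line.
Qed.

End Engel.

(** * Generalized eigenspaces *)

Section GeneralizedEigenvectors.
Variables (k : closedFieldType) (V : vectType k) (A : V -> V).
Hypothesis A_linear : linear A.
Implicit Types (S : {vspace V}) (v w : V) (a b : k).

HB.instance Definition _ := GRing.isLinear.Build k V V _ A A_linear.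

Definition shift a v := A v - a *: v.

Fact shift_linear a : linear (shift a).
Proof.
move=> c u v; rewrite /shift linearP scalerDr scalerBr opprD addrACA.
by rewrite !scalerA mulrC.
Qed.

HB.instance Definition _ a := GRing.isLinear.Build k V V _ (shift a) (shift_linear a).

Definition gen_eig a v := exists m, iter m (shift a) v = 0.

Lemma iter_shift0 a m : iter m (shift a) 0 = 0.
Proof. by elim: m => //= m ->; rewrite linear0. Qed.

Lemma iter_shiftP a m c u v :
  iter m (shift a) (c *: u + v) = c *: iter m (shift a) u + iter m (shift a) v.
Proof. by elim: m => //= m ->; rewrite linearP. Qed.

Lemma gen_eigP a c u v : gen_eig a u -> gen_eig a v -> gen_eig a (c *: u + v).
Proof.
move=> [m um] [p vp]; exists (m + p)%N; rewrite iter_shiftP.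
rewrite [iter _ _ v]iterD vp iter_shift0 addr0 addnC iterD um iter_shift0.
exact: scaler0.
Qed.

Lemma gen_eig0 a : gen_eig a 0. Proof. by exists 0. Qed.

Lemma gen_eigenvector a v : gen_eig a v -> v != 0 -> exists2 w, w != 0 & A w = a *: w.
Proof.
case=> m; elim: m v => [|m IH] v; first by move=> /= -> /eqP.
rewrite iterSr => vm v0; have [|] := eqVneq (shift a v) 0; last exact: IH.
by move=> /eqP; rewrite subr_eq0 => /eqP; exists v.
Qed.

Lemma shiftC a b v : shift a (shift b v) = shift b (shift a v).
Proof.
have AB u w : A (u - w) = A u - A w by rewrite linearB.
have AZ c w : A (c *: w) = c *: A w by rewrite linearZ.
rewrite /shift !AB !AZ !scalerBr !scalerA [b * a]mulrC.
by rewrite !opprB !addrA [RHS](ACl (1*4*3*2)).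

Qed.

Lemma iter_shiftC a b m v : iter m (shift a) (shift b v) = shift b (iter m (shift a) v).
Proof. by elim: m => //= m ->; rewrite shiftC. Qed.

Lemma gen_eig_eq0 a b v : a != b -> gen_eig a v -> gen_eig b v -> v = 0.
Proof.
move=> ab [m]; elim: m v => [|m IH] v //; rewrite iterSr => vm [p vp].
have /eqP : shift a v = 0.
  by apply: IH => //; exists p; rewrite iter_shiftC vp linear0.
rewrite subr_eq0 => /eqP Av.
have : iter p (shift b) v = (a - b) ^+ p *: v.
  elim: p {vp} => [|p IHp] /=; first by rewrite scale1r.
  by rewrite IHp linearZ /= /shift Av -scalerBl scalerA exprSr.
by rewrite vp => /esym/eqP; rewrite scaler_eq0 expf_eq0 subr_eq0 (negPf ab) andbF => /eqP.
Qed.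

Definition stable S := {in S, forall v, A v \in S}.

Lemma stable_shift S a : stable S -> {in S, forall v, shift a v \in S}.
Proof. by move=> AS v vS; rewrite /shift rpredB ?rpredZ ?AS. Qed.

(** An eigenvector of the matrix of [A] on a basis of [S]. *)
Lemma stable_eigenvector S : stable S -> S != 0%VS ->
  exists a v, [/\ v \in S, v != 0 & A v = a *: v].
Proof.
move=> AS S0; pose n := \dim S; pose b := vbasis S.
pose M : 'M[k]_n := \matrix_(i, j) coord b j (A b`_i).
have bS (i : 'I_n) : b`_i \in S by rewrite vbasis_mem ?mem_nth ?size_tuple.
have [a] : exists a, root (char_poly M) a.
  by apply/closed_rootP; rewrite size_char_poly eqSS dimv_eq0.
rewrite -eigenvalue_root_char => /eigenvalueP[u uM u0].
exists a, (\sum_i u 0 i *: b`_i); split.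
- by apply: rpred_sum => i _; rewrite rpredZ.
- apply: contra u0 => /eqP H.
  have /freeP/(_ (u 0) H) u0 := basis_free (vbasisP S).
  by apply/eqP/rowP => i; rewrite mxE u0.
rewrite linear_sum scaler_sumr.
transitivity (\sum_i \sum_j (u 0 i * M i j) *: b`_j).
  apply: eq_bigr => i _; rewrite linearZ /= (coord_vbasis (AS _ (bS i))) scaler_sumr.
  by apply: eq_bigr => j _; rewrite mxE scalerA.
rewrite exchange_big /=; apply: eq_bigr => j _; rewrite -scaler_suml scalerA.
by congr (_ *: _); move/rowP/(_ j): uM; rewrite !mxE.
Qed.

(** [A - a] is the invertible scalar [b - a] plus an operator nilpotent at [v]. *)
Lemma gen_eig_preimage S a b v : stable S -> a != b -> v \in S -> gen_eig b v ->
  exists2 w, w \in S /\ gen_eig b w & v = shift a w.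
Proof.
move=> AS ab vS [m]; elim: m v vS => [|m IH] v vS.
  move=> /= ->; exists 0; last by rewrite linear0.
  by split; [exact: mem0v | exact: gen_eig0].
rewrite iterSr => vm.
have [w [wS bw] Ew] := IH _ (stable_shift b AS vS) vm.
have ba0 : b - a != 0 by rewrite subr_eq0 eq_sym.
exists ((b - a)^-1 *: (v - w)).
  split; first by rewrite rpredZ ?rpredB.
  rewrite -[_ *: _]addr0; apply: gen_eigP (gen_eig0 _).
  rewrite addrC -scaleN1r; apply: gen_eigP => //.
  by exists m.+1; rewrite iterSr.
have -> : shift a ((b - a)^-1 *: (v - w)) = (b - a)^-1 *: (shift a v - shift a w).
  by rewrite linearZ linearB.
rewrite -Ew /shift opprB [X in _ *: X]addrC subrKA -scalerBl.
by rewrite scalerA mulVf ?scale1r.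
Qed.

(** A stable subspace is the sum of its generalized eigenspaces, in the form of
    an induction principle.  If [a] is an eigenvalue on [S], the image of [S] under
    [A - a] is smaller and decomposes; by [gen_eig_preimage] its components for
    eigenvalues other than [a] lift to [S], and what remains of [v] is a
    generalized [a]-eigenvector. *)
Lemma gen_eig_ind S (P : V -> Prop) : stable S ->
  (forall u v, P u -> P v -> P (u + v)) ->
  (forall a v, v \in S -> gen_eig a v -> P v) -> {in S, forall v, P v}.
Proof.
move=> AS PD Pg.
pose Q S v := forall P : V -> Prop, (forall u v, P u -> P v -> P (u + v)) ->
  (forall a v, v \in S -> gen_eig a v -> P v) -> P v.
suff QS : {in S, forall v, Q S v} by move=> v vS; apply: QS vS _ PD Pg.
move: {2}(\dim S) (leqnn (\dim S)) => d; elim: d S AS {P PD Pg} => [|d IH] S AS dS v vS.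
  move: dS vS; rewrite leqn0 dimv_eq0 => /eqP->; rewrite memv0 => /eqP-> P PD.
  by move/(_ 0 0); apply; [apply: mem0v | apply: gen_eig0].
have [S0|S0] := eqVneq S 0%VS.
  move: vS; rewrite S0 memv0 => /eqP-> P PD.
  by move/(_ 0 0); apply; [apply: mem0v | apply: gen_eig0].
have [a [w [wS w0 Aw]]] := stable_eigenvector AS S0.
pose f := linfun (shift a).
have fE u : f u = shift a u by rewrite lfunE.
have fS : (f @: S <= S)%VS.
  by apply/subvP => _ /memv_imgP[u uS ->]; rewrite fE stable_shift.
have AfS : stable (f @: S)%VS.
  move=> _ /memv_imgP[u uS ->]; rewrite fE /shift linearB linearZ /=.
  by rewrite -[_ - _]/(shift a (A u)) -fE memv_img ?AS.
have dfS : (\dim (f @: S) <= d)%N.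
  rewrite -ltnS; apply: leq_trans dS; rewrite -(limg_ker_dim f S) -[X in (X < _)%N]add0n.
  rewrite ltn_add2r lt0n dimv_eq0; apply: contra w0 => /eqP kS.
  have : w \in (S :&: lker f)%VS by rewrite memv_cap wS memv_ker fE /shift Aw subrr eqxx.
  by rewrite kS memv0.
have [|||u [x [uS Qu ax Eu]]] := IH _ AfS dfS (shift a v) _ (fun y => exists u x,
    [/\ u \in S, Q S u, gen_eig a x & y = shift a u + x]).
- by rewrite -fE memv_img.
- move=> y1 y2 [u1 [x1 [u1S q1 g1 ->]]] [u2 [x2 [u2S q2 g2 ->]]].
  exists (u1 + u2), (x1 + x2); split; first exact: rpredD.
  + by move=> P PD Pg; apply: (PD); [apply: q1 | apply: q2].
  + by rewrite -[x1]scale1r; apply: gen_eigP.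
  + by rewrite linearD addrACA.
- move=> b y yfS yb; have yS := subvP fS y yfS.
  have [ab|ab] := eqVneq a b.
    exists 0, y; split; rewrite ?mem0v ?linear0 ?add0r ?ab //.
    by move=> P PD /(_ b 0); apply; [apply: mem0v | apply: gen_eig0].
  have [u [uS ub] ->] := gen_eig_preimage AS ab yS yb.
  exists u, 0; split; rewrite ?addr0 //; last exact: gen_eig0.
  by move=> P _ /(_ b u); apply.
move=> P PD Pg; rewrite -(subrK u v) addrC; apply: (PD); first exact: Qu.
apply: (Pg a); first by rewrite rpredB.
by case: ax => m xm; exists m.+1; rewrite iterSr linearB /= Eu addrC addKr.
Qed.

End GeneralizedEigenvectors.

(** * Cartan's criterion *)

(** The factorization of an idempotent through its image; it gives its trace
    and the compression of a representation to an invariant summand. *)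
Lemma idempotent_factor (k : fieldType) n (E : 'M[k]_n) : E *m E = E ->
  row_base E *m col_base E = 1%:M.
Proof.
move=> EE.
have [L LC] := row_fullP (col_base_full E).
have [R BR] := row_freeP (row_base_free E).
move: (row_base E) (col_base E) (mulmx_base E) BR LC => B C BC BR LC.
have : L *m (C *m B *m (C *m B)) *m R = L *m (C *m B) *m R by rewrite BC EE.
by rewrite !mulmxA LC !mul1mx -!mulmxA BR !mulmx1.
Qed.

Lemma idempotent_trace (k : fieldType) n (E : 'M[k]_n) : E *m E = E ->
  \tr E = (\rank E)%:R.
Proof.
by move=> EE; rewrite -{1}(mulmx_base E) mxtrace_mulC idempotent_factor // mxtrace1.
Qed.

Lemma nilpotent_trace (k : closedFieldType) n (N : 'M[k]_n) m :
  N ^+ m = 0 -> \tr N = 0.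
Proof.
move=> Nm; case: n N Nm => [|n] N Nm; first by rewrite [N]flatmx0 linear0.
have [r Er] := closed_field_poly_normal (char_poly N).
rewrite (monicP (char_poly_monic N)) scale1r in Er.
have r0 z : z \in r -> z = 0.
  move=> zr; have : root (char_poly N) z by rewrite Er root_prod_XsubC.
  rewrite -eigenvalue_root_char => /eigenvalueP[v vN v0].
  have : v *m N ^+ m = z ^+ m *: v.
    elim: (m) => [|p IH]; first by rewrite !expr0 mulmx1 scale1r.
    by rewrite exprSr mulmxA IH -scalemxAl vN scalerA -exprSr.
  rewrite Nm mulmx0 => /esym/eqP; rewrite scaler_eq0 (negPf v0) orbF expf_eq0.
  by case/andP=> _ /eqP.
have sr : size r = n.+1.
  by apply/succn_inj; rewrite -(size_char_poly N) Er size_prod_XsubC.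
have Ec : char_poly N = 'X^(n.+1).
  rewrite Er -sr (eq_big_seq (fun=> 'X)) => [|z /r0->]; last by rewrite subr0.
  by rewrite big_const_seq count_predT -Monoid.iteropE.
have := char_poly_trace N (ltn0Sn n); rewrite Ec coefXn /= -[n == _]/(n == n.+1).
by rewrite eqn_leq ltnn andbF => /esym/eqP; rewrite oppr_eq0 => /eqP.
Qed.

(** Fitting decomposition: [E] projects onto the generalized kernel of [C] and
    [D] inverts [C] on the complementary summand.  Both are polynomials in [C]. *)
Lemma fitting (k : fieldType) n (C : 'M[k]_n) : exists E D m,
  [/\ E *m E = E, C ^+ m *m E = 0, C *m D = 1%:M - E &
   forall B, B *m C = C *m B -> B *m E = E *m B /\ B *m D = D *m B].
Proof.
case: n C => [|n] C.
  by exists 0, 0, 0%N; split; rewrite ?flatmx0 // => B _; rewrite [B]flatmx0 !mulmx0.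
have [m [q q0 Eq]] := multiplicity_XsubC (char_poly C) 0.
rewrite (monic_neq0 (char_poly_monic C)) /= in q0.
rewrite subr0 in Eq.
have : coprimep q ('X^(m.+1)).
  by apply: coprimep_expr; rewrite -['X]subr0 -polyC0 coprimep_XsubC.
case/Bezout_eq1_coprimepP=> -[u w] /= Euw.
have CH : horner_mx C q *m C ^+ m = 0.
  have := Cayley_Hamilton C; rewrite Eq rmorphM rmorphXn /= horner_mx_X.
  by rewrite mulmxE.
pose E := horner_mx C (u * q); pose D := horner_mx C (w * 'X^m).
have comC p : horner_mx C p *m C = C *m horner_mx C p.
  exact: comm_horner_mx.
have EC : C ^+ m *m E = 0.
  have -> : C ^+ m = horner_mx C ('X^m) by rewrite rmorphXn /= horner_mx_X.
  rewrite mulmxE -rmorphM mulrC -mulrA rmorphM /= [X in _ * X]rmorphM /= rmorphXn /= horner_mx_X.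
  by rewrite -[X in _ * X]/(_ *m _) CH mulr0.
have CD : C *m D = 1%:M - E.
  rewrite -{1}[C]horner_mx_X mulmxE -rmorphM mulrCA -exprS.
  rewrite -[1%:M](rmorph1 (horner_mx C)) -rmorphB; congr horner_mx.
  by rewrite -Euw addrC addKr.
exists E, D, m; split=> //.
  have -> : E *m E = E - (1%:M - E) *m E by rewrite mulmxBl mul1mx opprB addrC subrK.
  suff -> : (1%:M - E) *m E = 0 by rewrite subr0.
  rewrite -CD /D rmorphM rmorphXn /= horner_mx_X mulmxE -!mulrA.
  by rewrite -[C ^+ m * E]/(C ^+ m *m E) EC !mulr0.
by move=> B BC; split; apply: comm_mx_horner.
Qed.

Section EigenProjectors.
Variables (k : closedFieldType) (n : nat) (X : 'M[k]_n).
Local Notation geig := (@gen_eig k 'cV[k]_n (mulmx X)).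

Fact mulmx_linear : linear (mulmx X : 'cV[k]_n -> 'cV[k]_n).
Proof. by move=> c u v; rewrite linearP. Qed.

Lemma iter_shift_mx a m v :
  iter m (shift (mulmx X) a) v = (X - a%:M) ^+ m *m v :> 'cV[k]_n.
Proof.
elim: m => [|m IH]; first by rewrite expr0 mul1mx.
by rewrite iterS IH exprS -mulmxE -mulmxA [RHS]mulmxBl mul_scalar_mx.
Qed.

(** The projector onto a generalized eigenspace is the Fitting projector of
    [X - a]; on its image [X] is [a] plus a nilpotent matrix, whence the trace. *)
Lemma eigen_projector a : exists E : 'M[k]_n,
  [/\ E *m E = E, forall v, geig a v -> E *m v = v,
      forall b v, b != a -> geig b v -> E *m v = 0,
      \tr (X *m E) = a * (\rank E)%:R &
      exists m, (X - a%:M) ^+ m *m E = 0].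
Proof.
pose C := X - a%:M; have [E [D [m [EE CE CD comE]]]] := fitting C.
have CX : X *m C = C *m X by rewrite /C mulmxBl mulmxBr scalar_mxC.
have [XE _] := comE X CX; have [CEc CDc] := comE C erefl.
exists E; split=> //; last by exists m.
- move=> v [p]; rewrite iter_shift_mx -/C => Cv.
  have CpE : C ^+ p *m E = E *m C ^+ p.
    by apply: (comE (C ^+ p) _).1; rewrite mulmxE -exprSr exprS.
  have inj q (w : 'cV[k]_n) : E *m w = 0 -> C ^+ q *m w = 0 -> w = 0.
    elim: q w => [|q IH] w Ew; first by rewrite expr0 mul1mx.
    rewrite exprSr -mulmxE -mulmxA => /IH Cw0.
    have {}Cw0 : C *m w = 0 by apply: Cw0; rewrite mulmxA -CEc -mulmxA Ew mulmx0.
    by rewrite -[w]mul1mx -[1%:M](subrK E) mulmxDl Ew addr0 -CD CDc -mulmxA Cw0 mulmx0.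
  apply/eqP; rewrite eq_sym -subr_eq0; apply/eqP/(inj p).
    by rewrite mulmxBr mulmxA EE subrr.
  by rewrite mulmxBr Cv mulmxA CpE -mulmxA Cv mulmx0 subrr.
- move=> b v ba vb; apply: (gen_eig_eq0 mulmx_linear ba).
    have [p] := vb; rewrite iter_shift_mx => Xv; exists p; rewrite iter_shift_mx.
    have /comE[/esym cE _] : (X - b%:M) ^+ p *m C = C *m (X - b%:M) ^+ p.
      apply: comm_mx_sym; elim: p {Xv} => [|p IH].
        by rewrite expr0; apply: comm_mx1.
      rewrite exprS; apply: comm_mxM IH.
      by apply: comm_mxB; [apply: comm_mx_sym | apply: comm_mx_scalar].
    by rewrite mulmxA -cE -mulmxA Xv mulmx0.
  by exists m; rewrite iter_shift_mx mulmxA CE mul0mx.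
have -> : X *m E = C *m E + a *: E by rewrite mulmxBl mul_scalar_mx subrK.
have nCE p : (C *m E) ^+ p.+1 = C ^+ p.+1 *m E.
  elim: p => [|p IH]; first by rewrite !expr1.
  rewrite exprS IH [C ^+ p.+2]exprS -!mulmxE -!mulmxA [E *m (_ *m _)]mulmxA.
  have /comE[<- _] : C ^+ p.+1 *m C = C *m C ^+ p.+1 by rewrite mulmxE -exprSr exprS.
  by rewrite -mulmxA EE.
rewrite mxtraceD mxtraceZ [\tr E]idempotent_trace // (@nilpotent_trace _ _ _ m.+1) ?add0r //.
by rewrite nCE exprS -mulmxE -mulmxA CE mulmx0.
Qed.

End EigenProjectors.

(** Stands in for a basis of the rational span of [rs]: coordinates are integers
    after multiplication by a common denominator [d]. *)
Lemma integer_coordinates (k : fieldType) (rs : seq k) :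
  exists (d : int) s (b : 'I_s -> k),
  [/\ d != 0, forall c : 'I_s -> int, \sum_i (c i)%:~R * b i = 0 -> c =1 (fun=> 0) &
      {in rs, forall z, exists c : 'I_s -> int, d%:~R * z = \sum_i (c i)%:~R * b i}].
Proof.
elim: rs => [|z rs [d [s [b [d0 fb cb]]]]].
  by exists 1, 0%N, (fun=> 0); split=> // c _ [].
have [[q [q0 [c Ec]]]|nd] := classic (exists q : int, q != 0 /\
    exists c : 'I_s -> int, q%:~R * z = \sum_i (c i)%:~R * b i).
  exists (d * q), s, b; split; rewrite ?mulf_neq0 // => y; rewrite inE => /predU1P[->|yr].
    exists (fun i => d * c i); rewrite intrM -mulrA Ec big_distrr.
    by apply: eq_bigr => i _ /=; rewrite intrM mulrA.
  have [c' Ec'] := cb y yr; exists (fun i => q * c' i).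
  rewrite intrM mulrAC Ec' big_distrl.
  by apply: eq_bigr => i _ /=; rewrite intrM mulrAC [q%:~R * _]mulrC.
exists d, s.+1, (fun i => oapp b z (unlift ord0 i)).
have sumE (c : 'I_s.+1 -> int) :
    \sum_i (c i)%:~R * oapp b z (unlift ord0 i) =
    (c ord0)%:~R * z + \sum_i (c (lift ord0 i))%:~R * b i.
  rewrite big_ord_recl unlift_none /=; congr (_ + _).
  by apply: eq_bigr => i _; rewrite liftK.
split=> // [c|y]; rewrite ?sumE.
  move=> Hc; have c0 : c ord0 = 0.
    apply/eqP/negPn/negP => c0; apply: nd; exists (c ord0); split=> //.
    exists (fun i => - c (lift ord0 i)); apply/eqP; rewrite -subr_eq0 -{2}[0]Hc.
    by rewrite -sumrN; apply/eqP; congr (_ + _); apply: eq_bigr => i _; rewrite intrN mulNr opprK.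
  move: Hc; rewrite c0 mul0r add0r => /fb Hc i.
  by case: (unliftP ord0 i) => [j ->|->]; [apply: Hc | apply: c0].
rewrite inE => /predU1P[->|/cb[c Ec]].
  exists (fun i => if i == ord0 then d else 0); rewrite sumE eqxx big1 ?addr0 // => i _.
  by rewrite lift_eqF mul0r.
exists (fun i => oapp c 0 (unlift ord0 i)); rewrite sumE unlift_none mul0r add0r Ec.
by apply: eq_bigr => i _; rewrite liftK.
Qed.

Lemma intr_pchar0 (k : fieldType) : [pchar k] =i pred0 ->
  forall i : int, (i%:~R == 0 :> k) = (i == 0).
Proof.
move=> /pcharf0P k0 [m|m]; first by rewrite -pmulrn k0.
by rewrite NegzE mulrNz oppr_eq0 -pmulrn k0.
Qed.

Lemma mulmx_cV_inj (k : fieldType) m n (A B : 'M[k]_(m, n)) :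
  (forall v : 'cV_n, A *m v = B *m v) -> A = B.
Proof.
move=> AB; apply/trmx_inj/row_matrixP => i.
by rewrite -!tr_col !colE AB.
Qed.

Section Cartan.
Variables (k : closedFieldType) (n : nat) (P : {vspace 'M[k]_n}).
Hypothesis k_char0 : [pchar k] =i pred0.
Hypothesis P_closed : lie_closed P.
Hypothesis P_perfect : forall K : {vspace 'M[k]_n},
  {in P &, forall A B, mxcomm A B \in K} -> (P <= K)%VS.
Hypothesis P_trace0 : {in P &, forall A B, \tr (A *m B) = 0}.
Local Notation geig X := (@gen_eig k 'cV[k]_n (mulmx X)).

Lemma eigenvalue_list (X : 'M[k]_n) : exists2 rs : seq k, uniq rs &
  (forall a v, v != 0 -> geig X a v -> a \in rs) /\
  {in rs, forall a, exists2 v, v != 0 & geig X a v}.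
Proof.
have [r Er] := closed_field_poly_normal (char_poly X^T).
rewrite (monicP (char_poly_monic _)) scale1r in Er.
have evE a : (a \in r) = eigenvalue X^T a.
  by rewrite eigenvalue_root_char Er root_prod_XsubC.
exists (undup r); [exact: undup_uniq | split=> a; rewrite mem_undup evE].
  move=> v v0 av; have [w w0 Xw] := gen_eigenvector av v0.
  apply/eigenvalueP; exists w^T; last by rewrite trmx_eq0.
  by rewrite -trmx_mul Xw linearZ.
move=> /eigenvalueP[v Xv v0]; exists v^T; first by rewrite trmx_eq0.
by exists 1%N; rewrite /= /shift -[X]trmxK -trmx_mul Xv linearZ subrr.
Qed.

(** Let [phi] be one of the integer coordinates of eigenvalues, an additive
    function, and let [Y] act by [phi a] on the generalized [a]-eigenspace of [X].
    The commutator with [Y] acts by [phi z] on the generalized [z]-eigenspace of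
    the commutator with [X], so it preserves [P], and since [P] is perfect
    [X *m Y] has trace zero.  This says that the sum of [phi a * a], weighted by
    multiplicities, vanishes; its coordinate for [phi] is a sum of squares, so
    [phi] vanishes on all eigenvalues. *)
Lemma cartan_nilpotent : {in P, forall X, exists m, X ^+ m = 0}.
Proof.
move=> X XP; have [rs urs [rsP rsE]] := eigenvalue_list X.
pose E a := proj1_sig (constructive_indefinite_description _ (eigen_projector X a)).
have EP a : [/\ E a *m E a = E a, forall v, geig X a v -> E a *m v = v,
      forall b v, b != a -> geig X b v -> E a *m v = 0,
      \tr (X *m E a) = a * (\rank (E a))%:R &
      exists m, (X - a%:M) ^+ m *m E a = 0].
  by rewrite /E; case: constructive_indefinite_description.
have [d [s [b [d0 fb cb]]]] := integer_coordinates rs.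
pose coords z (c : 'I_s -> int) := d%:~R * z = \sum_i (c i)%:~R * b i.
pose C z := epsilon (inhabits (fun _ : 'I_s => 0 : int)) (coords z).
have CP z : z \in rs -> coords z (C z).
  by move/cb/(epsilon_spec (inhabits (fun _ : 'I_s => 0 : int)) (coords z)).
have C_uniq z c : coords z c -> C z =1 c.
  move=> zc i; have : coords z (C z).
    by apply: (epsilon_spec _ (coords z)); exists c.
  rewrite /coords zc => /eqP; rewrite eq_sym -subr_eq0 -sumrB => /eqP H.
  apply/eqP; rewrite -subr_eq0; apply/eqP.
  apply: (fb (fun i => C z i - c i)); rewrite -[RHS]H.
  by apply: eq_bigr => j _; rewrite intrB mulrBl.
have a0 a : a \in rs -> a = 0.
  move=> ars.
  suff C0 j : C a j = 0.
    have := CP a ars; rewrite /coords big1 => [/eqP|i _]; last by rewrite C0 mul0r.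
    by rewrite mulf_eq0 intr_pchar0 // (negPf d0) => /eqP.
  pose phi z : k := (C z j)%:~R.
  have phiD y z : y \in rs -> y + z \in rs -> phi (y + z) - phi y = phi z.
    move=> yrs yzrs; rewrite /phi -intrB; congr (_ %:~R).
    symmetry; apply: (C_uniq z (fun i => C (y + z) i - C y i)).
    rewrite /coords -[in LHS](addrK y z) [z + y]addrC mulrBr (CP _ yzrs) (CP _ yrs) -sumrB.
    by apply: eq_bigr => i _; rewrite intrB mulrBl.
  pose Y := \sum_(z <- rs) phi z *: E z.
  have Yv z v : geig X z v -> Y *m v = phi z *: v.
    move=> zv; have [->|v0] := eqVneq v 0; first by rewrite mulmx0 scaler0.
    have zrs := rsP _ _ v0 zv.
    rewrite mulmx_suml (bigD1_seq z) //= -scalemxAl.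
    have [_ -> // _ _ _] := EP z; rewrite big1 ?addr0 // => y yz.
    rewrite -scalemxAl; have [_ _ EPy _ _] := EP y.
    by rewrite (EPy z) ?scaler0 // eq_sym.
  have YP : {in P, forall B, mxcomm Y B \in P}.
    apply: (gen_eig_ind (A := mxcomm X)); first exact: mxcomm_linearr.
    - by move=> B BP; apply: P_closed.
    - by move=> B B' BP B'P; rewrite -[B]scale1r mxcomm_linearr scale1r rpredD.
    move=> z B BP [m zB].
    suff -> : mxcomm Y B = phi z *: B by rewrite rpredZ.
    apply: mulmx_cV_inj => v; move: v (memvf v).
    apply: (gen_eig_ind (A := mulmx X)); first exact: mulmx_linear.
    - by move=> v _; apply: memvf.
    - by move=> u v Eu Ev; rewrite !mulmxDr Eu Ev.
    move=> y v _ yv; have yzBv : geig X (y + z) (B *m v).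
      have [p pv] := yv; exists (m + p)%N.
      apply: (iter_leibniz (b := fun (B : 'M[k]_n) (v : 'cV[k]_n) => B *m v)) zB pv.
      - exact: mul0mx.
      - exact: mulmx0.
      - by rewrite /shift mulmx0 scaler0 subrr.
      - by move=> u w; rewrite /shift mulmxDr scalerDr opprD addrACA.
      move=> D w; rewrite /shift /mxcomm mulmxBr !mulmxBl -!scalemxAl -!scalemxAr !mulmxA.
      by rewrite scalerDl opprD !addrA [RHS](ACl (1*5*3*(2*4))) /= addNr addr0.
    rewrite mulmxBl -!mulmxA (Yv _ _ yv) (Yv _ _ yzBv) -scalemxAr -scalerBl -scalemxAl.
    have [->|Bv0] := eqVneq (B *m v) 0; first by rewrite !scaler0.
    rewrite phiD //; last exact: rsP yzBv.
    by apply: rsP yv; apply: contra Bv0 => /eqP->; rewrite mulmx0.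
  have trXY : \tr (X *m Y) = 0.
    have lt : linear (fun Z : 'M[k]_n => \tr (Z *m Y) : k^o).
      by move=> c A B; rewrite mulmxDl mxtraceD -scalemxAl mxtraceZ.
    pose t : 'Hom('M[k]_n, k^o) := linfun (fun Z : 'M[k]_n => \tr (Z *m Y) : k^o).
    have tE Z : t Z = \tr (Z *m Y) by exact: linfunE.
    suff /subvP/(_ X XP) : (P <= lker t)%VS by rewrite memv_ker tE => /eqP.
    apply: P_perfect => A B AP BP; rewrite memv_ker tE /mxcomm mulmxBl linearB /=.
    rewrite -!mulmxA [\tr (B *m _)]mxtrace_mulC -!mulmxA -linearB -mulmxBr /=.
    have YB : mxcomm Y B \in P by exact: YP.
    by have := P_trace0 AP YB; rewrite /mxcomm -opprB mulmxN linearN => /eqP; rewrite oppr_eq0.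
  have sum0 : \sum_(z <- rs) (C z j)%:~R * (z * (\rank (E z))%:R) = 0 :> k.
    rewrite -[RHS]trXY mulmx_sumr linear_sum; apply: eq_bigr => z _ /=.
    by rewrite -scalemxAr mxtraceZ; have [_ _ _ -> _] := EP z.
  have : \sum_(z <- rs) C z j ^+ 2 * (\rank (E z))%:R = 0.
    apply: (fb (fun i => \sum_(z <- rs) C z j * C z i * (\rank (E z))%:R) _ j).
    rewrite -[RHS](mulr0 d%:~R) -[in RHS]sum0 big_distrr /=.
    transitivity (\sum_i \sum_(z <- rs) (C z j * C z i * (\rank (E z))%:R)%:~R * b i).
      by apply: eq_bigr => i _; rewrite rmorph_sum big_distrl.
    rewrite exchange_big /=; apply: eq_big_seq => z zrs.
    rewrite mulrCA [d%:~R * _]mulrA (CP _ zrs) big_distrl /= big_distrr /=.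
    by apply: eq_bigr => i _; rewrite !intrM natz -pmulrn -!mulrA [b i * _]mulrC.
  move/eqP; rewrite psumr_eq0 => [|z _]; last by rewrite mulr_ge0 ?sqr_ge0 ?ler0n.
  move/allP/(_ a ars); rewrite mulf_eq0 expf_eq0 /= pnatr_eq0 => /orP[/eqP //|].
  rewrite mxrank_eq0 => /eqP E0; have [v v0 av] := rsE a ars.
  have [_ /(_ v av) Ev _ _ _] := EP a; case/eqP: v0.
  by rewrite -Ev E0 mul0mx.
have [_ E1 _ _ [m mE]] := EP 0; exists m.
move: mE; rewrite raddf0 subr0; suff -> : E 0 = 1%:M by rewrite mulmx1.
apply: mulmx_cV_inj => v; rewrite mul1mx; move: v (memvf v).
apply: (gen_eig_ind (A := mulmx X)); first exact: mulmx_linear.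
- by move=> v _; apply: memvf.
- by move=> u v Eu Ev; rewrite mulmxDr Eu Ev.
move=> y v _ yv; have [->|v0] := eqVneq v 0; first by rewrite mulmx0.
by apply: E1; rewrite -(a0 y) //; apply: rsP yv.
Qed.

(** By [cartan_nilpotent] and Engel's theorem, as [P] is perfect. *)
Theorem cartan_criterion : P = 0%VS.
Proof. exact: (nilpotent_perfect0 P_closed cartan_nilpotent P_perfect). Qed.

End Cartan.

(** * Whitehead's first lemma for the even part *)

Section Coordinates.
Variables (k : fieldType) (V : vectType k).
Let b := vbasis {:V}.
Local Notation d := (\dim {:V}).

Definition cvec (v : V) : 'cV[k]_d := \col_i coord b i v.
Definition vecc (c : 'cV[k]_d) : V := \sum_i c i 0 *: b`_i.
Definition mxend (f : 'End(V)) : 'M[k]_d := \matrix_(i, j) coord b i (f b`_j).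

Lemma cvecK : cancel cvec vecc.
Proof.
move=> v; rewrite {2}(coord_vbasis (memvf v)).
by apply: eq_bigr => i _; rewrite mxE.
Qed.

Lemma veccK : cancel vecc cvec.
Proof.
move=> c; apply/colP => i; rewrite mxE.
by rewrite (coord_sum_free _ _ (basis_free (vbasisP _))).
Qed.

Lemma cvec_linear : linear cvec.
Proof. by move=> c u v; apply/colP => i; rewrite !mxE linearP. Qed.

Lemma cvec0 : cvec 0 = 0.
Proof. by apply/colP => i; rewrite !mxE linear0. Qed.

Lemma mxend_cvec f v : mxend f *m cvec v = cvec (f v).
Proof.
apply/colP => i; rewrite !mxE {2}(coord_vbasis (memvf v)) !linear_sum.
by apply: eq_bigr => j _; rewrite !mxE !linearZ mulrC.
Qed.

Lemma mxend_unique A (f : 'End(V)) : (forall v, A *m cvec v = cvec (f v)) -> A = mxend f.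
Proof. by move=> Af; apply: mulmx_cV_inj => v; rewrite -[v]veccK mxend_cvec. Qed.

Lemma mxend_linear : linear mxend.
Proof.
move=> c f g; symmetry; apply: mxend_unique => v.
rewrite mulmxDl -scalemxAl !mxend_cvec -cvec_linear; congr cvec.
by rewrite add_lfunE scale_lfunE.
Qed.

End Coordinates.

Section Orthogonal.
Variables (k : fieldType) (V : vectType k) (B : V -> V -> k^o) (S U : {vspace V}).
Hypothesis B_linearl : forall u, linear (B^~ u).
Hypothesis B_linearr : forall u, linear (B u).

Let pairing (x : V) : 'rV[k]_(\dim U) := \row_i B x (vbasis U)`_i.

Definition orth : {vspace V} := (S :&: lker (linfun pairing))%VS.

Lemma pairing_linear : linear pairing.
Proof. by move=> c x y; apply/rowP => i; rewrite !mxE B_linearl. Qed.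

Lemma mem_orthP x : reflect (x \in S /\ {in U, forall y, B x y = 0}) (x \in orth).
Proof.
rewrite memv_cap memv_ker linfunE; last exact: pairing_linear.
apply: (iffP andP) => [[xS /eqP/rowP Bx]|[xS Bx]]; split=> //.
  move=> y /coord_vbasis->; rewrite -[B x _](linfunE (B_linearr x)) linear_sum big1 // => i _.
  rewrite linearZ /= linfunE; last exact: B_linearr.
  by have := Bx i; rewrite !mxE => ->; rewrite scaler0.
apply/eqP/rowP => i; rewrite !mxE Bx // vbasis_mem // mem_nth // size_tuple.
by [].
Qed.

Lemma dim_orth : (\dim S <= \dim orth + \dim U)%N.
Proof.
rewrite -(limg_ker_dim (linfun pairing) S) leq_add2l.
by apply: leq_trans (dimvS (subvf _)) _; rewrite dimvf dim_matrix -[X in (_ <= X)%N]mul1n leqnn.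
Qed.

End Orthogonal.

Section EvenPart.
Variables (k : closedFieldType) (g : lieSuper k).
Hypothesis k_char0 : [pchar k] =i pred0.
Hypothesis g0_ss : ev_semisimple g.
Local Notation g0 := (hpart g false).

Lemma lbr_even : {in g0 &, forall x y, lbr x y \in g0}.
Proof. by move=> x y x0 y0; have := lbr_graded x0 y0. Qed.

Lemma lbr_evenN : {in g0 &, forall x y, lbr x y = - lbr y x}.
Proof. by move=> x y x0 y0; rewrite (lbr_skew x0 y0) /= scale1r. Qed.

Lemma lbr_even_jacobi : {in g0 &, forall x y z,
  lbr (lbr x y) z = lbr x (lbr y z) - lbr y (lbr x z)}.
Proof.
move=> x y x0 y0; apply: hpart_ind => [u v Eu Ev|c z zc].
  by rewrite !linearD /= Eu Ev addrACA.
by rewrite (lbr_jacobi x0 y0 zc) /= scale1r addrK.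
Qed.

Definition even_rep n (rho : 'Hom(g, 'M[k]_n)) :=
  {in g0 &, forall x y, rho (lbr x y) = mxcomm (rho x) (rho y)}.

Definition even_ideal (S : {vspace g}) :=
  (S <= g0)%VS /\ {in g0, forall x, {in S, forall y, lbr x y \in S}}.

Definition trace_form n (rho : 'Hom(g, 'M[k]_n)) (x y : g) : k^o :=
  \tr (rho x *m rho y).

Lemma trace_form_linearl n (rho : 'Hom(g, 'M[k]_n)) y : linear (trace_form rho ^~ y).
Proof.
by move=> c u v; rewrite /trace_form linearP mulmxDl -scalemxAl mxtraceD mxtraceZ.
Qed.

Lemma trace_form_linearr n (rho : 'Hom(g, 'M[k]_n)) x : linear (trace_form rho x).
Proof.
by move=> c u v; rewrite /trace_form linearP mulmxDr -scalemxAr mxtraceD mxtraceZ.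
Qed.

Lemma trace_form_inv n (rho : 'Hom(g, 'M[k]_n)) x y z : even_rep rho ->
  x \in g0 -> y \in g0 -> z \in g0 ->
  trace_form rho (lbr x y) z + trace_form rho y (lbr x z) = 0.
Proof.
move=> rr x0 y0 z0; rewrite /trace_form !rr // /mxcomm mulmxBl mulmxBr !linearB /=.
by rewrite !mulmxA addrA subrK [\tr (rho x *m _ *m _)]mxtrace_mulC mulmxA
  [\tr (rho z *m _ *m _)]mxtrace_mulC mulmxA -[rho y *m rho z *m rho x]mulmxA mxtrace_mulC subrr.
Qed.

Lemma mem_lbrv (U W : {vspace g}) x y : x \in U -> y \in W -> lbr x y \in lbrv U W.
Proof.
move=> /coord_vbasis-> /coord_vbasis->; rewrite [lbr _]linear_sum sum_lfunE.
apply: rpred_sum => i _; rewrite linearZ /= scale_lfunE linear_sum rpredZ //.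
apply: rpred_sum => j _; rewrite linearZ rpredZ //=; apply/memv_span/allpairs_f;
  by rewrite mem_nth // size_tuple.
Qed.

Lemma lbrv_sub (U W K : {vspace g}) :
  (forall x y, x \in U -> y \in W -> lbr x y \in K) -> (lbrv U W <= K)%VS.
Proof.
move=> H; apply/span_subvP => _ /allpairsP[[x y] [/= xU yW ->]].
by apply: H; apply: vbasis_mem.
Qed.

(** Cartan's criterion for ideals: the derived series of [S] becomes stationary
    at a perfect subalgebra, whose image under [rho] vanishes. *)
Lemma trace_form_ideal0 n (rho : 'Hom(g, 'M[k]_n)) (S : {vspace g}) :
  even_rep rho -> even_ideal S -> {in S, forall x, rho x = 0 -> x = 0} ->
  {in S &, forall x y, trace_form rho x y = 0} -> S = 0%VS.
Proof.
move=> rr [S0 Sid] Sinj Str; apply: g0_ss.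
  by split=> //; apply: lbrv_sub => x y x0 yS; apply: Sid.
pose D i := iter i (fun U => lbrv U U) S.
have DS i : (D i <= S)%VS /\ (D i.+1 <= D i)%VS.
  elim: i => [|i [DS IH]].
    by split=> //; apply: lbrv_sub => x y xS yS; apply: Sid => //; apply: (subvP S0).
  split; first exact: subv_trans IH DS.
  by apply: lbrv_sub => x y xD yD; apply: mem_lbrv; apply: (subvP IH).
have [i Di] : exists i, (D i <= D i.+1)%VS.
  apply: NNPP => H; have dD i : (\dim (D i) + i <= \dim S)%N.
    elim: i => [|i IH]; first by rewrite addn0.
    apply: leq_trans IH; rewrite addnS -addSn leq_add2r.
    rewrite (ltn_leqif (dimv_leqif_sup (DS i).2)); apply/negP => Di.
    by apply: H; exists i.
  by have := leq_trans (leq_addl _ _) (dD (\dim S).+1); rewrite ltnn.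
exists i; rewrite -/(D i); set P := D i in Di.
have PS := subvP (DS i).1; have P0 : {subset P <= g0} by move=> x /PS/(subvP S0).
have Q0 : (rho @: P)%VS = 0%VS.
  apply: (cartan_criterion k_char0).
  - move=> _ _ /memv_imgP[x xP ->] /memv_imgP[y yP ->].
    rewrite -rr ?P0 // memv_img //; apply: (subvP (DS i).2); exact: mem_lbrv.
  - move=> K HK; apply/subvP => _ /memv_imgP[x /(subvP Di) xP ->].
    rewrite memv_preim; move: x xP; apply/subvP/lbrv_sub => x y xP yP.
    by rewrite -memv_preim rr ?P0 // HK ?memv_img.
  - by move=> _ _ /memv_imgP[x xP ->] /memv_imgP[y yP ->]; apply: Str; apply: PS.
apply/eqP; rewrite -subv0; apply/subvP => x xP; rewrite memv0.
by apply/eqP/Sinj; [apply: PS | apply/eqP; rewrite -memv0 -Q0 memv_img].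
Qed.

Definition adm : 'Hom(g, 'M[k]_(\dim {:g})) := linfun (fun x => mxend (lbr x)).

Lemma admE x : adm x = mxend (lbr x).
Proof.
apply: (linfunE (f := fun x => mxend (lbr x))) => c u v.
by rewrite linearP mxend_linear.
Qed.

Lemma adm_rep : even_rep adm.
Proof.
move=> x y x0 y0; rewrite !admE; symmetry; apply: mxend_unique => v.
rewrite /mxcomm mulmxBl -!mulmxA !mxend_cvec lbr_even_jacobi //.
by have := cvec_linear (-1) (lbr y (lbr x v)) (lbr x (lbr y v));
  rewrite !scaleN1r ![- _ + _]addrC.
Qed.

(** The kernel is an abelian ideal of the even part. *)
Lemma adm_inj : {in g0, forall x, adm x = 0 -> x = 0}.
Proof.
move=> x x0 ax; have lx : lbr x = 0.
  apply/lfunP => y; rewrite zero_lfunE; apply: (can_inj (@cvecK _ _)).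
  by rewrite -mxend_cvec -admE ax mul0mx cvec0.
have : x \in (g0 :&: lker (@lbr k g))%VS by rewrite memv_cap x0 memv_ker lx /=.
suff -> : (g0 :&: lker (@lbr k g))%VS = 0%VS by rewrite memv0 => /eqP.
have zl u v : u \in (g0 :&: lker (@lbr k g))%VS -> lbr u v = 0.
  by rewrite memv_cap memv_ker => /andP[_ /eqP->]; rewrite zero_lfunE.
apply: g0_ss.
  split; first exact: capvSl.
  apply: lbrv_sub => u v u0 vZ; rewrite lbr_evenN //; last by move: vZ; rewrite memv_cap => /andP[].
  by rewrite (zl v u vZ) oppr0 mem0v.
exists 1%N => /=; apply/eqP; rewrite -subv0; apply: lbrv_sub => u v uZ _.
by rewrite (zl u v uZ) mem0v.
Qed.


Section Complement.
Variables (n : nat) (rho : 'Hom(g, 'M[k]_n)).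
Hypothesis rho_rep : even_rep rho.

Let I : {vspace g} := (g0 :&: lker rho)%VS.
Let kappa := trace_form adm.

(** A complement of the kernel of [rho] in the even part: [rho] is faithful on it,
    with nondegenerate trace form. *)
Definition ker_orth : {vspace g} := orth kappa g0 I.
Local Notation J := ker_orth.

Lemma mem_ker_orthP x :
  reflect (x \in g0 /\ {in I, forall y, kappa x y = 0}) (x \in J).
Proof. exact: mem_orthP (trace_form_linearl _) (trace_form_linearr _) _. Qed.

Lemma ideal_kernel : even_ideal I.
Proof.
split; first exact: capvSl.
move=> x x0 y; rewrite !memv_cap !memv_ker => /andP[y0 /eqP ry].
by rewrite lbr_even // rho_rep // ry /mxcomm mulmx0 mul0mx subrr eqxx.
Qed.

Lemma ideal_ker_orth : even_ideal J.
Proof.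
split; first exact: capvSl.
move=> x x0 y /mem_ker_orthP[y0 yI]; apply/mem_ker_orthP; split; first exact: lbr_even.
move=> z zI; have z0 := subvP ideal_kernel.1 z zI.
have /eqP := trace_form_inv adm_rep x0 y0 z0; rewrite [X in _ + X]yI ?addr0; first by move/eqP.
exact: ideal_kernel.2.
Qed.

(** The trace form of the adjoint representation vanishes on the intersection of
    the kernel with its orthogonal, which is therefore zero by Cartan's
    criterion. *)
Lemma ker_orth_inj : {in J, forall x, rho x = 0 -> x = 0}.
Proof.
move=> x xJ rx; have xIJ : x \in (I :&: J)%VS.
  by rewrite (memv_cap _ I J) xJ memv_cap (subvP ideal_ker_orth.1 x xJ) memv_ker rx eqxx.
suff IJ0 : (I :&: J)%VS = 0%VS by apply/eqP; rewrite -memv0 -IJ0.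
apply: (trace_form_ideal0 adm_rep).
- split; first exact: subv_trans (capvSl _ _) ideal_kernel.1.
  move=> y y0 z; rewrite !(memv_cap _ I J) => /andP[zI zJ].
  by rewrite ideal_kernel.2 ?ideal_ker_orth.2.
- move=> y; rewrite (memv_cap _ I J) => /andP[/(subvP ideal_kernel.1) y0 _].
  exact: adm_inj.
- move=> y z; rewrite !(memv_cap _ I J) => /andP[_ /mem_ker_orthP[_ yI]] /andP[zI _].
  exact: yI.
Qed.

Lemma ker_orth_eq0 : J = 0%VS -> {in g0, forall x, rho x = 0}.
Proof.
move=> J0 x x0; suff gI : (g0 <= I)%VS.
  by have := subvP gI x x0; rewrite memv_cap memv_ker => /andP[_ /eqP].
have := dim_orth kappa g0 I.
rewrite -[orth _ _ _]/J J0 dimv0 add0n => dg.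
have := dimv_leqif_sup ideal_kernel.1; move/leqifP; case: ifP => // _.
by rewrite ltnNge dg.
Qed.

(** The radical of the trace form of [rho] on [J] is an ideal on which [rho] is
    faithful and its trace form zero. *)
Lemma ker_orth_nondeg x : x \in J -> {in J, forall y, trace_form rho x y = 0} -> x = 0.
Proof.
move=> xJ xo; pose S := orth (trace_form rho) J J.
have mS := @mem_orthP _ _ _ J J (trace_form_linearl rho) (trace_form_linearr rho).
have /mS xS : x \in J /\ {in J, forall y, trace_form rho x y = 0} by [].
have J0 := subvP ideal_ker_orth.1.
suff S0 : S = 0%VS by apply/eqP; rewrite -memv0 -S0.
apply: (trace_form_ideal0 rho_rep).
- split; first exact: subv_trans (capvSl _ _) ideal_ker_orth.1.
  move=> y y0 z /mS[zJ zo]; apply/mS; split; first exact: ideal_ker_orth.2.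
  move=> w wJ; have /eqP := trace_form_inv rho_rep y0 (J0 _ zJ) (J0 _ wJ).
  by rewrite [X in _ + X]zo ?addr0 ?ideal_ker_orth.2 // => /eqP.
- by move=> y /mS[yJ _]; apply: ker_orth_inj.
- by move=> y z /mS[_ yo] /mS[zJ _]; apply: yo.
Qed.

Let d := \dim J.
Let x_ (i : 'I_d) : g := (vbasis J)`_i.
Let gram : 'M[k]_d := \matrix_(i, j) trace_form rho (x_ i) (x_ j).

Fact x_J i : x_ i \in J.
Proof. by rewrite vbasis_mem ?mem_nth ?size_tuple. Qed.

Lemma gram_unit : gram \in unitmx.
Proof.
rewrite -row_free_unit -kermx_eq0; apply/eqP/row_matrixP => i; rewrite row0.
have : row i (kermx gram) *m gram = 0 by rewrite -row_mul mulmx_ker row0.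
move: (row i _) => u uG.
pose x := \sum_j u 0 j *: x_ j.
have xJ : x \in J by apply: rpred_sum => j _; rewrite rpredZ ?x_J.
have x0 : x = 0.
  apply: ker_orth_nondeg => // y /coord_vbasis->.
  have tfr := trace_form_linearr rho x.
  rewrite -[trace_form _ _ _](linfunE tfr) linear_sum big1 // => j _.
  rewrite linearZ /= linfunE // -/(x_ j).
  have tfl := trace_form_linearl rho (x_ j).
  rewrite -[trace_form _ _ _](linfunE tfl) linear_sum.
  rewrite (_ : \sum_i _ = 0) ?scaler0 //.
  have /rowP/(_ j) := uG; rewrite !mxE => E; rewrite -[RHS]E; apply: eq_bigr => l _.
  by rewrite linearZ /= linfunE // mxE.
apply/rowP => j; rewrite [RHS]mxE.
by have /freeP/(_ (u 0) x0 j) := basis_free (vbasisP J).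
Qed.

(** The Casimir tensor of [J] contracted with an arbitrary bilinear map: the
    same invariance then yields both a commuting operator and a primitive of a
    cocycle. *)
Definition casimir (Z : lmodType k) (b : g -> g -> Z) : Z :=
  \sum_i \sum_j invmx gram i j *: b (x_ i) (x_ j).

(** Invariance of the trace form says that the matrix of [lbr y] on [J] is skew
    for the Gram matrix, hence also for its inverse. *)
Lemma casimir_inv (Z : vectType k) (b : g -> g -> Z) y : bilin b -> y \in g0 ->
  casimir (fun u v => b (lbr y u) v + b u (lbr y v)) = 0.
Proof.
move=> [bl br] y0.
pose a : 'M[k]_d := \matrix_(i, l) coord (vbasis J) l (lbr y (x_ i)).
have yx i : lbr y (x_ i) = \sum_l a i l *: x_ l.
  rewrite {1}(coord_vbasis (ideal_ker_orth.2 _ y0 _ (x_J i))).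
  by apply: eq_bigr => l _; rewrite mxE.
have bsl i v : b (lbr y (x_ i)) v = \sum_l a i l *: b (x_ l) v.
  rewrite yx -[b _ v](linfunE (bl v)) linear_sum; apply: eq_bigr => l _.
  by rewrite linearZ /= linfunE.
have bsr i v : b v (lbr y (x_ i)) = \sum_l a i l *: b v (x_ l).
  rewrite yx -[b v _](linfunE (br v)) linear_sum; apply: eq_bigr => l _.
  by rewrite linearZ /= linfunE.
have aG : a *m gram + gram *m a^T = 0.
  apply/matrixP => i j; rewrite !mxE -[RHS](trace_form_inv rho_rep y0
    (subvP ideal_ker_orth.1 _ (x_J i)) (subvP ideal_ker_orth.1 _ (x_J j))).
  rewrite !yx -[trace_form _ (\sum__ _) _](linfunE (trace_form_linearl rho _)).
  rewrite -[trace_form _ _ (\sum__ _)](linfunE (trace_form_linearr rho _)) !linear_sum.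
  congr (_ + _); apply: eq_bigr => l _; rewrite linearZ /= linfunE;
    do ?[exact: trace_form_linearl | exact: trace_form_linearr]; rewrite !mxE //.
  by rewrite mulrC.
have aC : a^T *m invmx gram + invmx gram *m a = 0.
  have := congr1 (fun M => invmx gram *m M *m invmx gram) aG.
  rewrite mulmx0 mul0mx mulmxDr mulmxDl !mulmxA mulVmx ?gram_unit // mul1mx.
  by rewrite mulmxK ?gram_unit // addrC.
transitivity (\sum_l \sum_j (a^T *m invmx gram + invmx gram *m a) l j *: b (x_ l) (x_ j)).
  transitivity (\sum_l \sum_j (a^T *m invmx gram) l j *: b (x_ l) (x_ j) +
      \sum_l \sum_j (invmx gram *m a) l j *: b (x_ l) (x_ j)); last first.
    rewrite -big_split; apply: eq_bigr => l _ /=; rewrite -big_split.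
    by apply: eq_bigr => j _ /=; rewrite -scalerDl [in RHS]mxE.
  rewrite /casimir; under eq_bigr => i _ do under eq_bigr => j _ do rewrite scalerDr.
  under eq_bigr => i _ do rewrite big_split /=.
  rewrite big_split /=; congr (_ + _).
    transitivity (\sum_i \sum_j \sum_l (a i l * invmx gram i j) *: b (x_ l) (x_ j)).
      apply: eq_bigr => i _; apply: eq_bigr => j _; rewrite bsl scaler_sumr.
      by apply: eq_bigr => l _; rewrite scalerA mulrC.
    etransitivity; first by apply: eq_bigr => i _; exact: exchange_big.
    rewrite exchange_big; apply: eq_bigr => l _; rewrite exchange_big /=.
    apply: eq_bigr => j _; rewrite -scaler_suml; congr (_ *: _).
    by rewrite [RHS]mxE; apply: eq_bigr => i _; rewrite !mxE.
  apply: eq_bigr => i _.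
  transitivity (\sum_j \sum_l (invmx gram i j * a j l) *: b (x_ i) (x_ l)).
    apply: eq_bigr => j _; rewrite bsr scaler_sumr.
    by apply: eq_bigr => l _; rewrite scalerA.
  rewrite exchange_big /=; apply: eq_bigr => l _; rewrite -scaler_suml; congr (_ *: _).
  by rewrite [RHS]mxE.
by rewrite aC big1 // => l _; rewrite big1 // => j _; rewrite mxE scale0r.
Qed.

Lemma casimir_trace : \tr (casimir (fun u v => rho u *m rho v)) = d%:R.
Proof.
rewrite -mxtrace1 -(mulVmx gram_unit) /casimir linear_sum; apply: eq_bigr => i _ /=.
rewrite linear_sum [RHS]mxE; apply: eq_bigr => j _ /=.
by rewrite mxtraceZ [gram j i]mxE [X in _ * X]mxtrace_mulC.
Qed.

End Complement.

(** A functional vanishing on brackets gives a representation by strictly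
    triangular matrices of size 2; its trace form is zero, so the representation
    is trivial. *)
Lemma perfect_even (l : 'Hom(g, k^o)) : {in g0 &, forall x y, l (lbr x y) = 0} ->
  {in g0, forall x, l x = 0}.
Proof.
move=> l0; pose N : 'M[k]_2 := delta_mx 0 1.
have NN : N *m N = 0 by rewrite mul_delta_mx_0.
pose rho : 'Hom(g, 'M[k]_2) := linfun (fun x => (l x : k) *: N).
have rhoE x : rho x = (l x : k) *: N.
  by apply: (linfunE (f := fun x => (l x : k) *: N)) => c u v; rewrite linearP scalerDl scalerA.
have rNN x y : rho x *m rho y = 0.
  by rewrite !rhoE -scalemxAl -scalemxAr NN !scaler0.
have rr : even_rep rho.
  by move=> x y x0 y0; rewrite /mxcomm !rNN subrr rhoE l0 // scale0r.
have J0 : ker_orth rho = 0%VS.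
  apply/eqP; rewrite -subv0; apply/subvP => x xJ; rewrite memv0; apply/eqP.
  by apply: (ker_orth_nondeg rr xJ) => y _; rewrite /trace_form rNN linear0.
move=> x x0; have /eqP := ker_orth_eq0 rr J0 x0.
rewrite rhoE scaler_eq0 => /orP[/eqP //|/eqP/matrixP/(_ 0 1)/eqP].
by rewrite !mxE !eqxx oner_eq0.
Qed.


(** The Casimir operator [c] commutes with [rho] and satisfies
    [rho y *m w0 = c *m phi y], which solves the equation on the summand where [c]
    is invertible.  The generalized kernel of [c] is a smaller representation,
    unless [c] is nilpotent; then the trace of [c] is zero, so [J] is zero and [rho]
    is trivial, and [phi] vanishes because the even part is perfect. *)
Theorem whitehead_mx n (rho : 'Hom(g, 'M[k]_n)) (phi : 'Hom(g, 'cV[k]_n)) :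
  even_rep rho ->
  {in g0 &, forall x y, phi (lbr x y) = rho x *m phi y - rho y *m phi x} ->
  exists w, {in g0, forall x, phi x = rho x *m w}.
Proof.
elim/ltn_ind: n rho phi => n IH rho phi rr cphi.
pose J := ker_orth rho.
have J0 : {subset J <= g0} := subvP (ideal_ker_orth rr).1.
pose c := casimir rho (fun u v => rho u *m rho v).
pose w0 := casimir rho (fun u v => rho u *m phi v).
have cas_mull p (A : 'M[k]_n) (b : g -> g -> 'M[k]_(n, p)) :
    A *m casimir rho b = casimir rho (fun u v => A *m b u v).
  rewrite mulmx_sumr; apply: eq_bigr => i _; rewrite mulmx_sumr.
  by apply: eq_bigr => j _; rewrite scalemxAr.
have cas_mulr p q (A : 'M[k]_(p, q)) (b : g -> g -> 'M[k]_(n, p)) :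
    casimir rho b *m A = casimir rho (fun u v => b u v *m A).
  rewrite mulmx_suml; apply: eq_bigr => i _; rewrite mulmx_suml.
  by apply: eq_bigr => j _; rewrite scalemxAl.
have casB (Z : lmodType k) (b b' : g -> g -> Z) :
    casimir rho b - casimir rho b' = casimir rho (fun u v => b u v - b' u v).
  rewrite -sumrB; apply: eq_bigr => i _; rewrite -sumrB.
  by apply: eq_bigr => j _; rewrite scalerBr.
have eq_cas (Z : lmodType k) (b b' : g -> g -> Z) :
    {in J &, forall u v, b u v = b' u v} -> casimir rho b = casimir rho b'.
  move=> E; apply: eq_bigr => i _; apply: eq_bigr => j _.
  by rewrite E ?x_J.
have cC y : y \in g0 -> rho y *m c = c *m rho y.
  move=> y0; apply/eqP; rewrite -subr_eq0 cas_mull cas_mulr casB; apply/eqP.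
  rewrite -[RHS](casimir_inv rr (b := fun u v => rho u *m rho v) _ y0).
    apply: eq_cas => u v /J0 u0 /J0 v0; rewrite !rr // /mxcomm.
    by rewrite mulmxBl mulmxBr !mulmxA addrA subrK.
  by split=> [v a u u'|v a u u']; rewrite linearP ?mulmxDl ?mulmxDr -?scalemxAl -?scalemxAr.
have cw y : y \in g0 -> rho y *m w0 = c *m phi y.
  move=> y0; apply/eqP; rewrite -subr_eq0 cas_mull cas_mulr casB; apply/eqP.
  rewrite -[RHS](casimir_inv rr (b := fun u v => rho u *m phi v) _ y0).
    apply: eq_cas => u v /J0 u0 /J0 v0; rewrite rr // cphi // /mxcomm.
    by rewrite mulmxBl mulmxBr !mulmxA addrA subrK.
  by split=> [v a u u'|v a u u']; rewrite linearP ?mulmxDl ?mulmxDr -?scalemxAl -?scalemxAr.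
have [E [D [m [EE cE cD comE]]]] := fitting c.
have [_ cDc] := comE c erefl.
suff [w Ew] : exists w, {in g0, forall x, E *m phi x = rho x *m w}.
  exists (D *m w0 + w) => x x0; rewrite mulmxDr -Ew // mulmxA.
  have [_ ->] := comE (rho x) (cC x x0).
  by rewrite -mulmxA cw // mulmxA -cDc cD -mulmxDl subrK mul1mx.
have [rE|rE] := ltnP (\rank E) n.
  have [r [A [B [rn AB BA]]]] : exists r (A : 'M[k]_(r, n)) (B : 'M[k]_(n, r)),
      [/\ (r < n)%N, A *m B = 1%:M & B *m A = E].
    exists (\rank E), (row_base E), (col_base E).
    by split; [| exact: idempotent_factor | exact: mulmx_base].
  have EB : E *m B = B by rewrite -BA -mulmxA AB mulmx1.
  have AE : A *m E = A by rewrite -BA mulmxA AB mul1mx.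
  have rE' x : x \in g0 -> rho x *m E = E *m rho x.
    by move=> x0; have [] := comE (rho x) (cC x x0).
  pose rho' := linfun (fun x => A *m rho x *m B) : 'Hom(g, 'M[k]_r).
  have rho'E x : rho' x = A *m rho x *m B.
    apply: (linfunE (f := fun x => A *m rho x *m B)) => a u v.
    by rewrite linearP mulmxDr mulmxDl -scalemxAr -scalemxAl.
  pose phi' := linfun (fun x => A *m phi x) : 'Hom(g, 'cV[k]_r).
  have phi'E x : phi' x = A *m phi x.
    apply: (linfunE (f := fun x => A *m phi x)) => a u v.
    by rewrite linearP mulmxDr -scalemxAr.
  have Brho x : x \in g0 -> B *m rho' x = rho x *m B.
    by move=> x0; rewrite rho'E !mulmxA BA -rE' // -mulmxA EB.
  have rho'A x : x \in g0 -> rho' x *m A = A *m rho x.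
    by move=> x0; rewrite rho'E -[_ *m B *m A]mulmxA BA -mulmxA rE' // mulmxA AE.
  have [||w' Ew'] := IH _ rn rho' phi'.
  - move=> x y x0 y0; rewrite rho'E rr // /mxcomm mulmxBr mulmxBl.
    rewrite !mulmxA -!rho'A // -!mulmxA.
    by rewrite -!Brho // !mulmxA -[_ *m A *m B]mulmxA AB mulmx1
      -[rho' y *m A *m B]mulmxA AB mulmx1.
  - move=> x y x0 y0; rewrite !phi'E cphi // mulmxBr !mulmxA.
    by rewrite !rho'A.
  exists (B *m w') => x x0; rewrite mulmxA -Brho // -mulmxA -Ew' //.
  by rewrite phi'E mulmxA BA.
have E1 : E = 1%:M.
  have uE : E \in unitmx.
    by rewrite -row_free_unit; apply/eqP/anti_leq; rewrite rank_leq_row.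
  by rewrite -[LHS](mulKmx uE) EE mulVmx.
have cm : c ^+ m = 0 by rewrite -[LHS]mulmx1 -E1.
have Jz : J = 0%VS.
  apply/eqP; rewrite -dimv_eq0; have /pcharf0P <- := k_char0.
  by rewrite -casimir_trace // (nilpotent_trace cm).
have r0 := ker_orth_eq0 rr Jz.
exists 0 => x x0; rewrite E1 mul1mx mulmx0; apply/colP => i; rewrite mxE.
pose l := linfun (fun x => phi x i 0 : k^o) : 'Hom(g, k^o).
have lE y : l y = phi y i 0.
  by apply: (linfunE (f := fun x => phi x i 0 : k^o)) => a u v; rewrite linearP !mxE.
rewrite -lE; apply: perfect_even x0 => y z y0 z0.
by rewrite lE cphi // !r0 // !mul0mx subrr mxE.
Qed.

Theorem whitehead (W : vectType k) (r : g -> W -> W) (phi : g -> W) :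
  bilin r -> linear phi ->
  {in g0 &, forall x y w, r (lbr x y) w = r x (r y w) - r y (r x w)} ->
  {in g0 &, forall x y, phi (lbr x y) = r x (phi y) - r y (phi x)} ->
  exists w, {in g0, forall x, phi x = r x w}.
Proof.
move=> [rl rr] phil rrep cphi.
pose rho := linfun (fun x => mxend (linfun (r x))) : 'Hom(g, 'M[k]_(\dim {:W})).
have rhoE x w : rho x *m cvec w = cvec (r x w).
  rewrite -[rho x]/(linfun _ x) linfunE; last first.
    move=> c u v; rewrite -mxend_linear; congr mxend; apply/lfunP => z.
    by rewrite add_lfunE scale_lfunE !linfunE //; apply: rl.
  by rewrite mxend_cvec linfunE.
pose psi := linfun (fun x => cvec (phi x)) : 'Hom(g, 'cV[k]_(\dim {:W})).
have psiE x : psi x = cvec (phi x).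
  apply: (linfunE (f := fun x => cvec (phi x))) => c u v.
  by rewrite phil cvec_linear.
have cvB u v : cvec (u - v) = cvec u - cvec v :> 'cV_(\dim {:W}).
  by rewrite addrC -scaleN1r cvec_linear scaleN1r addrC.
have [||w Ew] := @whitehead_mx _ rho psi.
- move=> x y x0 y0; apply: mulmx_cV_inj => v; rewrite -[v]veccK rhoE /mxcomm.
  by rewrite rrep // cvB mulmxBl -!mulmxA !rhoE.
- by move=> x y x0 y0; rewrite !psiE cphi // cvB !rhoE.
exists (vecc w) => x x0; apply: (can_inj (@cvecK _ _)).
by rewrite -psiE Ew // -rhoE veccK.
Qed.

(** The primitive can be found in any submodule that contains the cocycle. *)
Corollary whitehead_sub (W : vectType k) (r : g -> W -> W) (phi : g -> W)
    (U : {vspace W}) :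
  bilin r -> linear phi ->
  {in g0 &, forall x y w, r (lbr x y) w = r x (r y w) - r y (r x w)} ->
  {in g0 &, forall x y, phi (lbr x y) = r x (phi y) - r y (phi x)} ->
  {in g0, forall x, {in U, forall u, r x u \in U}} ->
  {in g0, forall x, phi x \in U} ->
  exists2 w, w \in U & {in g0, forall x, phi x = r x w}.
Proof.
move=> [rl rr] phil rrep cphi rU phiU.
have [||||w Ew] := @whitehead (subvs_of U)
    (fun x u => vsproj U (r x (vsval u))) (fun x => vsproj U (phi x)).
- split=> [u c x y|x c u v].
    by have /= -> := rl (vsval u) c x y; rewrite linearP.
  by rewrite [vsval _]linearP rr linearP.
- by move=> c x y; rewrite phil linearP.
- move=> x y x0 y0 u; apply: subvs_inj; rewrite [RHS]linearB /=.
  have uU : vsval u \in U := subvsP u.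
  by rewrite !vsprojK ?rU ?lbr_even // rrep.
- move=> x y x0 y0; apply: subvs_inj; rewrite [RHS]linearB /=.
  by rewrite !vsprojK ?rU ?phiU ?lbr_even // cphi.
exists (vsval w); first exact: subvsP.
move=> x x0; have := congr1 vsval (Ew x x0).
by rewrite !vsprojK ?rU ?phiU ?subvsP.
Qed.

End EvenPart.

(** * Weyl's theorem *)

Section Weyl.
Variables (k : closedFieldType) (g : lieSuper k).
Hypothesis k_char0 : [pchar k] =i pred0.
Hypothesis g0_ss : ev_semisimple g.
Local Notation g0 := (hpart g false).

Lemma even_act_lbr (M : smod g) x y (m : M) : x \in g0 -> y \in g0 ->
  act (lbr x y) m = act x (act y m) - act y (act x m).
Proof. by move=> x0 y0; rewrite (act_lbr m x0 y0) scale1r. Qed.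

Lemma hproj_act (M : smod g) a x (m : M) : x \in g0 ->
  hproj M a (act x m) = act x (hproj M a m).
Proof.
move=> x0; move: m; apply: hpart_ind => [u v Eu Ev|b m mb].
  by rewrite !linearD /= Eu Ev.
have := act_graded x0 mb; rewrite addFb => xmb.
by rewrite !(hprojE _ mb) (hprojE _ xmb); case: eqP => // _; rewrite linear0.
Qed.

(** The obstruction to making an even projection onto [U] commute with the
    even part is a cocycle with values in the even endomorphisms that vanish on
    [U] and have image in [U]. *)
Theorem weyl (M : smod g) : inF M.
Proof.
move=> U [Ugr Uact].
pose Ua a := (U :&: hpart M a)%VS.
have Udec u : u \in U -> hproj M false u \in U /\ hproj M true u \in U.
  move=> /(subvP Ugr)/memv_addP[u0 u0U [u1 u1U ->]].
  move: u0U u1U; rewrite !memv_cap => /andP[u0U u00] /andP[u1U u11].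
  rewrite !linearD /= !(hprojE _ u00) !(hprojE _ u11) /=.
  by rewrite addr0 add0r.
have UdecP a u : u \in U -> hproj M a u \in U.
  by move=> /Udec[]; case: a.
pose p : 'End(M) := (\sum_a (projv (Ua a) \o hproj M a))%VF.
have pE m : p m = projv (Ua false) (hproj M false m) + projv (Ua true) (hproj M true m).
  by rewrite /p sum_lfunE big_bool /= !comp_lfunE addrC.
have [pU1 pUh] : (forall a m, projv (Ua a) m \in U) /\
    (forall a m, projv (Ua a) m \in hpart M a).
  by split=> a m; have := memv_proj (Ua a) m; rewrite memv_cap => /andP[].
have pU m : p m \in U by rewrite pE rpredD.
have pid u : u \in U -> p u = u.
  move=> uU; have uUa a : hproj M a u \in Ua a by rewrite memv_cap UdecP ?hproj_mem.
  by rewrite pE (projv_id (uUa false)) (projv_id (uUa true)) hprojD.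
have php a m : hproj M a (p m) = p (hproj M a m).
  rewrite !pE linearD /=.
  rewrite (hprojE _ (pUh false _)) (hprojE _ (pUh true _)).
  rewrite (hprojE false (hproj_mem a m)) (hprojE true (hproj_mem a m)).
  by case: a; rewrite /= linear0 ?addr0 ?add0r.
pose r x (T : 'End(M)) : 'End(M) := (act x \o T)%VF - (T \o act x)%VF.
have rE x T m : r x T m = act x (T m) - T (act x m).
  by rewrite /r add_lfunE opp_lfunE !comp_lfunE.
pose Wd (T : 'End(M)) : ('End(M) * 'End(M) * 'End(M))%type :=
  ((T \o projv U)%VF, T - (projv U \o T)%VF, (hproj M false \o T)%VF - (T \o hproj M false)%VF).
have Wl : linear Wd.
  move=> c S T; rewrite /Wd; congr (_, _, _); apply/lfunP => m;
  rewrite !(comp_lfunE, add_lfunE, opp_lfunE, scale_lfunE) ?linearP //=.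
    by rewrite addrACA -scalerDr.
  by rewrite addrACA -scalerDr.
pose W := lker (linfun Wd).
have WP (T : 'End(M)) : reflect [/\ {in U, forall u, T u = 0}, forall m, T m \in U &
    forall a m, hproj M a (T m) = T (hproj M a m)] (T \in W).
  rewrite memv_ker linfunE //; apply: (iffP eqP) => [[H1 H2 H3]|[H1 H2 H3]].
    split=> [u uU|m|].
    - by have /lfunP/(_ u) := H1; rewrite comp_lfunE projv_id // zero_lfunE.
    - have /lfunP/(_ m)/eqP := H2; rewrite add_lfunE opp_lfunE comp_lfunE zero_lfunE.
      by rewrite subr_eq0 => /eqP->; apply: memv_proj.
    have F0 m : hproj M false (T m) = T (hproj M false m).
      have /lfunP/(_ m)/eqP := H3; rewrite add_lfunE opp_lfunE !comp_lfunE zero_lfunE.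
      by rewrite subr_eq0 => /eqP.
    case=> m; last exact: F0.
    have E n : hproj M true n = n - hproj M false n by rewrite -{2}(hprojD n) addrC addKr.
    by rewrite !E F0 linearB.
  rewrite /Wd; congr (_, _, _); apply/lfunP => m;
    rewrite ?(comp_lfunE, add_lfunE, opp_lfunE, zero_lfunE).
  - by rewrite H1 // memv_proj.
  - by rewrite projv_id ?subrr.
  - by rewrite H3 subrr.
have rbil : bilin r.
  split=> [T c x y|x c S T]; apply/lfunP => m;
    rewrite !(rE, add_lfunE, scale_lfunE) ?linearP ?add_lfunE ?scale_lfunE /=.
    by rewrite linearP opprD -scalerN addrACA -scalerDr.
  by rewrite addrACA -scalerDr.
have rrep : {in g0 &, forall x y (T : 'End(M)), r (lbr x y) T = r x (r y T) - r y (r x T)}.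
  move=> x y x0 y0 T; apply/lfunP => m; rewrite add_lfunE opp_lfunE !rE.
  rewrite !even_act_lbr // !linearB /=.
  by rewrite !opprK !addrA [RHS](ACl (1*5*8*4*(2*7)*(3*6))) /= !addNr !addr0.
have [||||||T /WP[TU0 TU Th] HT] := @whitehead_sub k g k_char0 g0_ss _ r (fun x => r x p) W.
- exact: rbil.
- by move=> c x y; exact: (rbil.1 p).
- exact: rrep.
- by move=> x y x0 y0; apply: rrep.
- move=> x x0 T /WP[T1 T2 T3]; apply/WP; split=> [u uU|m|a m]; rewrite !rE.
  + by rewrite (T1 u uU) (T1 _ (Uact x u x0 uU)) linear0 subrr.
  + by rewrite rpredB ?Uact.
  + by rewrite linearB /= hproj_act // !T3 hproj_act.
- move=> x x0; apply/WP; split=> [u uU|m|a m]; rewrite !rE.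
  + by rewrite (pid u uU) (pid _ (Uact x u x0 uU)) subrr.
  + by rewrite rpredB ?Uact.
  + by rewrite linearB /= hproj_act // !php hproj_act.
pose q : 'End(M) := p - T.
have qE m : q m = p m - T m by rewrite add_lfunE opp_lfunE.
have qU m : q m \in U by rewrite qE rpredB.
have qid u : u \in U -> q u = u by move=> uU; rewrite qE pid // TU0 // subr0.
have qact x m : x \in g0 -> q (act x m) = act x (q m).
  move=> x0; have /lfunP/(_ m) := HT x x0; rewrite !rE !qE linearB /=.
  move=> E; rewrite -[p (act x m)](subKr (act x (p m))) E.
  by rewrite opprB addrA addrAC addrK.
exists (lker q); split.
- split=> [|x u x0]; last by rewrite !memv_ker qact // => /eqP->; rewrite linear0.
  apply/subvP => u uK; rewrite -(hprojD u).
  have hK a : hproj M a u \in (lker q :&: hpart M a)%VS.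
    rewrite memv_cap hproj_mem andbT memv_ker qE -php -Th -linearB -qE.
    by move: uK; rewrite memv_ker => /eqP->; rewrite linear0.
  exact: memv_add (hK false) (hK true).
- apply/eqP; rewrite eqEsubv subvf; apply/subvP => m _.
  rewrite -[m](subrK (q m)) addrC memv_add //.
  by rewrite memv_ker linearB /= [q (q m)]qid ?subrr.
- apply/eqP; rewrite -subv0; apply/subvP => m.
  by rewrite memv_cap memv_ker memv0 => /andP[/qid ->].
Qed.

End Weyl.

(** * First-order deformations of endotrivial modules are trivial *)

Lemma psgnK (k : fieldType) (V : superSpace k) a : involutive (psgn V a).
Proof.
apply: hpart_ind => [u v Eu Ev|b v vb]; first by rewrite !linearD /= Eu Ev.
rewrite (psgnE a vb) linearZ /= (psgnE a vb) scalerA -signr_addb addbb.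
by rewrite expr0 scale1r.
Qed.

Section Form.
Variables (k : fieldType) (g : lieSuper k) (M : smod g).
Local Notation MM := (tens_smod M (dual_smod M)).
Implicit Types (A B : 'End(M)).

(** On homogeneous elements this pairing is [f (A m)] with the sign given by the
    degree of [A m]; for [A] the identity it is the evaluation map, which is
    invariant.  It identifies the endomorphisms of [M] with the linear forms on
    [MM]. *)
Definition str_form A : 'Hom(tens M (dual_space M), k^o) :=
  tlift (fun (m : M) (f : 'Hom(M, k^o)) => f (psgn M true (A m))).

Lemma str_formE A m (f : dual_space M) : str_form A (tprod m f) = f (psgn M true (A m)).
Proof.
apply: tliftE; split=> [h c u v|u c f' h]; first by rewrite !linearP.
by rewrite add_lfunE scale_lfunE.
Qed.

Lemma str_form_linear : linear str_form.
Proof.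
move=> c A B; apply: tens_ext => m f.
by rewrite add_lfunE scale_lfunE !str_formE (add_lfunE _ _ m) scale_lfunE !linearP.
Qed.

Lemma dual_ext (u v : M) : (forall f : 'Hom(M, k^o), f u = f v) -> u = v.
Proof.
move=> uv; rewrite (coord_vbasis (memvf u)) (coord_vbasis (memvf v)).
apply: eq_bigr => i _; congr (_ *: _).
have := uv (linfun (coord (vbasis {:M}) i : M -> k^o)).
by rewrite !lfunE.
Qed.

Lemma str_form_inj A B : str_form A = str_form B -> A = B.
Proof.
move=> AB; apply/lfunP => m; apply: (inv_inj (psgnK true)).
by apply: dual_ext => f; have := congr1 (fun h : 'Hom(_, _) => h (tprod m f)) AB;
  rewrite !str_formE.
Qed.

Lemma str_form_surj h : exists A, str_form A = h.
Proof.
pose b := vbasis {:M}.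
pose f i : 'Hom(M, k^o) := linfun (coord b i : M -> k^o).
pose F (m : M) : M := psgn M true (\sum_i h (tprod m (f i)) *: b`_i).
have Fl : linear F.
  move=> c u v; rewrite /F -linearP scaler_sumr -big_split; congr (psgn _ _ _).
  apply: eq_bigr => i _ /=; rewrite tprodDl tprodZl linearP scalerDl.
  by rewrite scalerA.
exists (linfun F); apply: tens_ext => m phi.
rewrite str_formE linfunE // /F psgnK linear_sum.
have E : phi = \sum_(i < \dim {:M}) phi b`_i *: f i.
  apply/lfunP => v; rewrite {1}(coord_vbasis (memvf v)) linear_sum sum_lfunE.
  by apply: eq_bigr => i _; rewrite linearZ /= scale_lfunE lfunE /= [LHS]mulrC.
have [_ tr] := @tprod_bilin k M (dual_space M).
rewrite [in RHS]E -[tprod m (\sum__ _)](linfunE (tr m)) !linear_sum.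
by apply: eq_bigr => i _; rewrite !linearZ /= linfunE // [LHS]mulrC.
Qed.

Definition hom_deg a A := forall b m, m \in hpart M b -> A m \in hpart M (a (+) b).

Lemma str_form_deg a A b t : hom_deg a A -> t \in hpart MM b -> a != b -> str_form A t = 0.
Proof.
move=> Aa tb ab; apply/eqP; rewrite -memv_ker; move: t tb; apply/subvP.
apply: tens_part_ind => c m f mc fd; rewrite memv_ker str_formE.
rewrite (psgnE true (Aa c m mc)) linearZ /=.
rewrite (mem_dual_partP _ _ fd) ?scaler0 //.
suff -> : ~~ (c (+) b) = a (+) c by apply: Aa.
by case: a b c ab {Aa mc fd} => -[] [].
Qed.

Lemma hproj_psgn (V : superSpace k) a b (v : V) :
  hproj V a (psgn V b v) = (-1) ^+ (b && a) *: hproj V a v.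
Proof.
move: v; apply: hpart_ind => [u v Eu Ev|c v vc]; first by rewrite !linearD /= Eu Ev.
rewrite (psgnE b vc) linearZ /= (hprojE _ vc).
by case: eqP => [->|_]; rewrite ?scaler0.
Qed.

Lemma deg_str_form A : (forall t, t \in hpart MM true -> str_form A t = 0) -> hom_deg false A.
Proof.
move=> A0 b m mb; rewrite addFb.
suff Am0 : hproj M (~~ b) (A m) = 0.
  have := hprojD (A m); case: b {mb} Am0 => /= ->; rewrite ?add0r ?addr0 => <-;
    exact: hproj_mem.
suff E : (-1) ^+ (true && ~~ b) *: hproj M (~~ b) (A m) = 0.
  by move/eqP: E; rewrite scaler_eq0 signr_eq0 => /eqP.
rewrite -hproj_psgn; apply: dual_ext => f; rewrite linear0 -comp_lfunE -dual_restrE.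
rewrite -str_formE A0 // -[true](_ : b (+) ~~ b = true); last by case: (b).
apply: mem_tens_part mb _; apply/mem_dual_partP => v; rewrite negbK => vb.
rewrite dual_restrE comp_lfunE (hproj0 vb) ?linear0 //.
by case: (b).
Qed.

(** Acting on the argument of [str_form A] amounts to taking the supercommutator of
    [A] with the action. *)
Lemma str_form_act a b A x t : hom_deg a A -> x \in hpart g b ->
  str_form A (tens_act M (dual_smod M) x t) =
  str_form ((A \o act x)%VF - (-1) ^+ (a && b) *: (act x \o A)%VF) t.
Proof.
move=> Aa xb; rewrite -comp_lfunE; congr (fun_of_lfun _ t); apply: tens_ext => m f.
rewrite comp_lfunE; move: m; apply: hpart_ind => [u v Eu Ev|c m mc].
  by rewrite !tprodDl !linearD /= Eu Ev.
move: f; apply: (@hpart_ind _ (dual_space M)) => [u v Eu Ev|d f fd].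
  by rewrite !tprodDr !linearD /= Eu Ev.
rewrite (tens_act_hom _ xb mc) linearD linearZ /= !str_formE.
rewrite (add_lfunE _ _ m) (opp_lfunE _ m) (scale_lfunE _ _ m) !comp_lfunE.
have Am := Aa _ _ mc; have xm := act_graded xb mc.
have Axm := Aa _ _ xm; have xAm := act_graded xb Am.
have {}xAm : act x (A m) \in hpart M (a (+) (b (+) c)) by rewrite addbCA.
have Dm : A (act x m) - (-1) ^+ (a && b) *: act x (A m) \in hpart M (a (+) (b (+) c)).
  by rewrite rpredB ?rpredZ.
rewrite (psgnE true Dm) (psgnE true Axm) (psgnE true Am) !andTb.
rewrite (dual_act_hom _ xb fd) ![act x (_ *: _)]linearZ /=.
have fZ a' v : f (a' *: v) = a' *: f v by rewrite linearZ.
have fB u v : f (u - v) = f u - f v by rewrite linearB.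
rewrite !fZ !fB !fZ.
have [dE|dE] := eqVneq d (a (+) (b (+) c)).
  rewrite scalerBr !scalerN !scalerA -!signr_addb dE; congr (_ - _ *: _).
  by congr (_ ^+ _); case: (a) (b) (c) => -[] [].
have dN : a (+) (b (+) c) = ~~ d by case: d (a (+) (b (+) c)) dE {fd Dm Axm xAm} => -[].
rewrite dN in Axm xAm.
by rewrite !(mem_dual_partP _ _ fd) // !scaler0 subr0 oppr0 !scaler0 addr0.
Qed.

End Form.

Section CocycleExtension.
Variables (k : fieldType) (g : lieSuper k) (M : smod g) (F : 'Hom(g, 'End(M))).
Local Notation MM := (tens_smod M (dual_smod M)).
Hypothesis F_deg : forall a x, x \in hpart g a -> hom_deg a (F x).
Hypothesis F_cocycle : forall a b x y m, x \in hpart g a -> y \in hpart g b ->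
  F (lbr x y) m = F x (act y m) + act x (F y m) -
    (-1) ^+ (a && b) *: (F y (act x m) + act y (F x m)).

Let V := dsum_space (ksup k) MM.

(* The action on [k (+) MM] in which [F] records how [MM] acts towards the trivial
   submodule. *)
Definition ext_act1 (x : g) : 'End(V) :=
  linfun (fun u : k^o * MM => (str_form (F x) u.2, act x u.2) : k^o * MM).

Definition ext_act : 'Hom(g, 'End(V)) := linfun ext_act1.

Lemma ext_actE x (u : V) : ext_act x u = (str_form (F x) u.2, act x u.2).
Proof.
have l1 y : linear (fun u : k^o * MM => (str_form (F y) u.2, act y u.2) : k^o * MM).
  by move=> c v w; rewrite /= !linearP.
have E y (v : V) : ext_act1 y v = (str_form (F y) v.2, act y v.2) by exact: (linfunE (l1 y)).
have l2 : linear ext_act1.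
  move=> c y z; apply/lfunP => v; rewrite add_lfunE scale_lfunE !E.
  by rewrite linearP str_form_linear [act (_ + _)]linearP !add_lfunE !scale_lfunE.
rewrite -E; congr (fun_of_lfun _ u); exact: (linfunE l2).
Qed.

Lemma ext_graded a b x m :
  x \in hpart g a -> m \in hpart V b -> ext_act x m \in hpart V (a (+) b).
Proof.
move=> xa; rewrite ext_actE !mem_dsum_part /= => /andP[_ m2].
rewrite (@act_graded _ _ MM _ _ _ _ xa m2) andbT.
have [->|ab] := eqVneq a b; first by rewrite addbb memvf.
by rewrite (@str_form_deg _ _ _ _ _ b m.2 (F_deg xa) m2 ab) mem0v.
Qed.

Lemma ext_lbr a b x y m : x \in hpart g a -> y \in hpart g b ->
  ext_act (lbr x y) m =
    ext_act x (ext_act y m) - (-1) ^+ (a && b) *: ext_act y (ext_act x m).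
Proof.
move=> xa yb; rewrite !ext_actE /=.
have E2 := @tens_lbr _ _ M (dual_smod M) _ _ _ _ m.2 xa yb.
suff E : str_form (F (lbr x y)) m.2 = str_form (F x) (tens_act M (dual_smod M) y m.2) -
    (-1) ^+ (a && b) *: str_form (F y) (tens_act M (dual_smod M) x m.2).
  exact: (congr2 pair E E2).
rewrite (str_form_act _ (F_deg xa) yb) (str_form_act _ (F_deg yb) xa) andbC.
have formP c A B t : str_form (c *: A + B) t = c *: str_form A t + str_form B t.
  by rewrite str_form_linear add_lfunE scale_lfunE.
rewrite -[RHS]addrC -scaleNr -formP; congr (fun_of_lfun (str_form _) _).
apply/lfunP => n; rewrite (F_cocycle _ xa yb).
rewrite !(add_lfunE _ _ n, opp_lfunE _ n, scale_lfunE _ _ n) !comp_lfunE.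
rewrite scaleNr scalerBr scalerDr scalerA -signr_addb addbb scale1r.
rewrite !opprD !opprK !addrA.
by rewrite [LHS](ACl (3*2*1*4)) /= [b && a]andbC.
Qed.

Definition cocycle_ext : smod g := SMod ext_graded ext_lbr.

Lemma cocycle_ext_snd : smod_hom (dsum_snd (ksup k) MM : 'Hom(cocycle_ext, MM)).
Proof.
split=> [a m|x m].
  by rewrite mem_dsum_part lfunE => /andP[].
by rewrite !lfunE /= ext_actE.
Qed.

End CocycleExtension.

(** Evenness of the inverse uses that the two parts of [N] meet in zero. *)
Lemma smod_hom_inv (k : fieldType) (g : lieSuper k) (M N : smod g)
    (f : 'Hom(M, N)) (f' : N -> M) :
  smod_hom f -> cancel f f' -> cancel f' f ->
  exists h : 'Hom(N, M), smod_hom h /\ h =1 f'.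
Proof.
move=> [fd fa] fK f'K.
have fl : linear f' by move=> c u v; apply: (can_inj fK); rewrite linearP /= !f'K.
exists (linfun f'); have hE := linfunE fl; split=> //; split=> [a n na|x n].
  rewrite hE; set m := f' n.
  have fm : f m = n by rewrite /m f'K.
  suff m0 : hproj M (~~ a) m = 0.
    have -> : m = hproj M a m; last exact: hproj_mem.
    by rewrite -[LHS](hprojD m); case: a {na} m0 => /= ->; rewrite ?add0r ?addr0.
  have fmh b : f (hproj M b m) \in hpart N b by apply: fd; apply: hproj_mem.
  apply: (can_inj fK); rewrite linear0; apply/eqP.
  rewrite -memv0 -(hpart_cap N a) memv_cap fmh andbT.
  have -> : f (hproj M (~~ a) m) = n - f (hproj M a m).
    have nE : n = f (hproj M false m) + f (hproj M true m) by rewrite -linearD /= hprojD fm.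
    by rewrite [X in X - _]nE; case: (a); rewrite /= ?addrK // addrC addKr.
  by rewrite rpredB.
by rewrite !hE; apply: (can_inj fK); rewrite fa !f'K.
Qed.

Section Rigidity.
Variables (k : closedFieldType) (g : lieSuper k).
Hypothesis k_char0 : [pchar k] =i pred0.
Hypothesis g0_ss : ev_semisimple g.
Variables (M : smod g) (F : 'Hom(g, 'End(M))).
Local Notation MM := (tens_smod M (dual_smod M)).
Hypothesis F_deg : forall a x, x \in hpart g a -> hom_deg a (F x).
Hypothesis F_cocycle : forall a b x y m, x \in hpart g a -> y \in hpart g b ->
  F (lbr x y) m = F x (act y m) + act x (F y m) -
    (-1) ^+ (a && b) *: (F y (act x m) + act y (F x m)).

(** The extension splits over a trivial summand [<[u]>]: the odd part acts by zero
    for degree reasons, and on the even part the expression is a functional that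
    vanishes on brackets. *)
Lemma str_form_invariant0 (u : MM) : u \in hpart MM false -> (forall x, act x u = 0) ->
  forall x, str_form (F x) u = 0.
Proof.
move=> u0 ua x; rewrite -(hprojD x) linearD /=.
have fD A B : str_form (A + B) u = str_form A u + str_form B u.
  by have := str_form_linear 1 A B; rewrite !scale1r => ->; rewrite add_lfunE.
rewrite fD (@str_form_deg _ _ _ true (F (hproj g true x)) false u) ?u0 ?addr0 //; last first.
  exact: (F_deg (hproj_mem true x)).
pose l : 'Hom(g, k^o) := linfun (fun x => str_form (F x) u).
have lE y : l y = str_form (F y) u.
  apply: (linfunE (f := fun y => str_form (F y) u)) => c v w.
  by rewrite linearP str_form_linear add_lfunE scale_lfunE.
rewrite -lE; apply: (perfect_even k_char0 g0_ss) (hproj_mem false x) => y z y0 z0.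
rewrite lE.
have := congr1 fst (ext_lbr F_deg F_cocycle ((0, u) : dsum_space (ksup k) MM) y0 z0).
rewrite !ext_actE /= => ->.
by rewrite [tens_act _ _ z u]ua [tens_act _ _ y u]ua !linear0 ?scaler0 ?oppr0 ?addr0.
Qed.

(** The extension of [MM] by the trivial module splits: over the projective
    summand by projectivity, over the trivial one by [str_form_invariant0]. *)
Theorem endotrivial_cocycle_inner : endotrivial M ->
  exists2 T : 'End(M), hom_deg false T &
    forall x m, F x m = T (act x m) - act x (T m).
Proof.
move=> [_ [P [[_ Pproj] [th [th_hom [th' thK th'K]]]]]].
have [hi [[hi_deg hi_act] hiE]] := smod_hom_inv th_hom thK th'K.
pose E := cocycle_ext F_deg F_cocycle.
pose iota : 'Hom(P, MM) := linfun (fun p => hi ((0, p) : dsum_smod (kev g) P)).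
have iotaE p : iota p = hi (0, p).
  apply: (linfunE (f := fun p => hi ((0, p) : dsum_smod (kev g) P))) => c u v.
  transitivity (hi ((c *: 0 + 0, c *: u + v) : dsum_smod (kev g) P)).
    by rewrite scaler0 addr0.
  exact: (linearP hi c (0, u) (0, v)).
have iota_hom : smod_hom iota.
  split=> [a p pa|x p]; rewrite !iotaE.
    by apply: hi_deg; rewrite mem_dsum_part mem0v.
  by rewrite -hi_act; congr (hi _); rewrite [RHS]dsum_actE /= linear0.
have [h' [[h'_deg h'_act] h'E]] : exists h' : 'Hom(P, E), smod_hom h' /\
    (dsum_snd (ksup k) MM \o h')%VF = iota.
  apply: Pproj => //; try exact: weyl.
    exact: cocycle_ext_snd.
  apply/eqP; rewrite eqEsubv subvf; apply/subvP => t _; apply/memv_imgP.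
  by exists ((0, t) : E); rewrite ?memvf // lfunE.
have h'2 p : (h' p).2 = iota p by rewrite -h'E comp_lfunE lfunE.
pose u : MM := hi (1, 0).
have u0 : u \in hpart MM false.
  by apply: hi_deg; rewrite mem_dsum_part /= memvf mem0v.
have ua x : act x u = 0.
  by rewrite -hi_act -[RHS](linear0 hi); congr (hi _);
    rewrite [LHS]dsum_actE /= !zero_lfunE linear0.
have dec t : t = (th t).1 *: u + iota (th t).2.
  rewrite iotaE -linearP -[LHS]thK -hiE; congr (hi _).
  case: (th t) => c p; transitivity ((c *: (1 : k^o) + 0, c *: 0 + p) : dsum_smod (kev g) P) => //.
  by rewrite scaler0 add0r addr0 [_ *: _]mulr1.
pose lam : 'Hom(tens M (dual_space M), k^o) := linfun (fun t : MM => (h' (th t).2).1).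
have lamE t : lam t = (h' (th t).2).1.
  apply: (linfunE (f := fun t : MM => (h' (th t).2).1)) => c v w.
  by rewrite linearP /= linearP.
have [T ET] := str_form_surj lam.
have T0 : hom_deg false T.
  apply: deg_str_form => t t1; rewrite ET lamE; apply/eqP; rewrite -memv0.
  have := th_hom.1 _ _ t1; rewrite mem_dsum_part => /andP[_ /h'_deg].
  by rewrite mem_dsum_part => /andP[].
exists T => // x m.
suff -> : F x = (T \o act x)%VF - (act x \o T)%VF.
  by rewrite (add_lfunE _ _ m) opp_lfunE !comp_lfunE.
move: x; apply: hpart_ind => [x y Ex Ey|a x xa].
  by rewrite !linearD /= Ex Ey comp_lfunDl comp_lfunDr opprD addrACA.
apply: str_form_inj; apply/lfunP => t.
have := str_form_act t T0 xa; rewrite andFb expr0 scale1r => <-.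
rewrite ET lamE [th _](th_hom.2 x t) [X in X.2]dsum_actE /= h'_act.
rewrite [X in X.1]ext_actE /= h'2 {1}[t]dec linearD linearZ /=.
by rewrite str_form_invariant0 // scaler0 add0r.
Qed.

End Rigidity.

(** * Supermodules as representations of a finitely presented algebra *)

Section SuperalgebraPresentation.
Variables (k : closedFieldType) (g : lieSuper k) (n : nat).
Hypothesis k_char0 : [pchar k] =i pred0.
Local Notation d := (\dim {:g}).

Lemma psgn_eig (V : superSpace k) (a : bool) (v : V) :
  psgn V true v = (-1) ^+ a *: v -> v \in hpart V a.
Proof.
have two0 : (2%:R : k) != 0 by have /pcharf0P -> := k_char0.
move=> sv; suff v0 : hproj V (~~ a) v = 0.
  have -> : v = hproj V a v; last exact: hproj_mem.
  by rewrite -[LHS](hprojD v); case: a {sv} v0 => /= ->; rewrite ?add0r ?addr0.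
have := congr1 (hproj V (~~ a)) sv; rewrite hproj_psgn linearZ /= => /eqP.
rewrite -subr_eq0 -scalerBl scaler_eq0 => /orP[|/eqP //].
by case: a {sv} => /=; rewrite expr0 expr1 ?opprK -?opprD ?oppr_eq0 -mulr2n (negPf two0).
Qed.

(** [None] is the grading operator and [Some (a, i)] the component of degree [a]
    of the basis vector [i] of [g].  With the grading operator among the
    generators, supermodules become representations of an ungraded algebra and
    even isomorphisms become plain intertwiners. *)
Definition generator : finType := option (bool * 'I_d).

Definition gen (p : bool * 'I_d) : g := hproj g p.1 (vbasis {:g})`_p.2.

Definition nclin (x : g) : ncpoly k generator :=
  foldr (fun l => NAdd (NMul (NConst (coord (vbasis {:g}) l x))
      (NAdd (NVar (Some (false, l))) (NVar (Some (true, l)))))) (NConst 0) (enum 'I_d).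

Definition ncsub (c : k) (p q : ncpoly k generator) := NAdd p (NMul (NConst (- c)) q).

Definition relation : finType :=
  option ((bool * 'I_d) + (bool * 'I_d) + (bool * 'I_d) * (bool * 'I_d)).

(** The components of the basis vectors span [g] without being independent; the
    relations [Some (inl (inr p))] record their linear dependencies, so that a function on
    the generators satisfying them extends linearly to [g]. *)
Definition superalgebra_rel (r : relation) : ncpoly k generator :=
  match r with
  | None => ncsub 1 (NMul (NVar None) (NVar None)) (NConst 1)
  | Some (inl (inl p)) => ncsub ((-1) ^+ p.1)
      (NMul (NVar None) (NVar (Some p))) (NMul (NVar (Some p)) (NVar None))
  | Some (inl (inr p)) => ncsub 1 (NVar (Some p)) (nclin (gen p))
  | Some (inr (p, q)) => ncsub 1 (ncsub ((-1) ^+ (p.1 && q.1))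
      (NMul (NVar (Some p)) (NVar (Some q))) (NMul (NVar (Some q)) (NVar (Some p))))
      (nclin (lbr (gen p) (gen q)))
  end.

Implicit Types (rho f : generator -> 'M[k]_n).

Definition linext f (x : g) : 'M[k]_n :=
  \sum_l coord (vbasis {:g}) l x *: (f (Some (false, l)) + f (Some (true, l))).

Lemma linext_linear f : linear (linext f).
Proof.
move=> c x y; rewrite /linext scaler_sumr -big_split; apply: eq_bigr => l _ /=.
by rewrite linearP scalerDl scalerA.
Qed.

Lemma nceval_ncsub rho c p q :
  nceval rho (ncsub c p q) = nceval rho p - c *: nceval rho q.
Proof. by rewrite /= mul_scalar_mx scaleNr. Qed.

Lemma ncder_ncsub rho f c p q :
  ncder rho rho f (ncsub c p q) = ncder rho rho f p - c *: ncder rho rho f q.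
Proof. by rewrite /= mul0mx add0r mul_scalar_mx scaleNr. Qed.

Lemma nceval_nclin rho x : nceval rho (nclin x) = linext rho x.
Proof.
rewrite /linext -big_enum /= /nclin; elim: (enum _) => [|l s IH] /=.
  by rewrite big_nil raddf0.
by rewrite big_cons IH mul_scalar_mx.
Qed.

Lemma ncder_nclin rho f x : ncder rho rho f (nclin x) = linext f x.
Proof.
rewrite /linext -big_enum /= /nclin; elim: (enum _) => [|l s IH] /=.
  by rewrite big_nil.
by rewrite big_cons IH mul_scalar_mx mul0mx add0r.
Qed.

Lemma gen_graded p : gen p \in hpart g p.1.
Proof. exact: hproj_mem. Qed.

Lemma gen_ind a (Q : g -> Prop) : Q 0 ->
  (forall c u v, Q u -> Q v -> Q (c *: u + v)) ->
  (forall l, Q (gen (a, l))) -> {in hpart g a, forall x, Q x}.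
Proof.
move=> Q0 QP Qg x xa.
have -> : x = \sum_l coord (vbasis {:g}) l x *: gen (a, l).
  rewrite -{1}(hproj_id xa) {1}(coord_vbasis (memvf x)) linear_sum.
  by apply: eq_bigr => l _; rewrite linearZ.
elim: (index_enum _) => [|l s IH]; first by rewrite big_nil.
by rewrite big_cons; apply: QP.
Qed.

Definition presented (M : smod g) rho := exists2 Phi : 'Hom(M, 'cV[k]_n), bijective Phi &
  (forall m, Phi (psgn M true m) = rho None *m Phi m) /\
  (forall p m, Phi (act (gen p) m) = rho (Some p) *m Phi m).

Lemma presented_linext (M : smod g) rho (Phi : 'Hom(M, 'cV[k]_n)) x m :
  (forall p m, Phi (act (gen p) m) = rho (Some p) *m Phi m) ->
  Phi (act x m) = linext rho x *m Phi m.
Proof.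
move=> Pg; rewrite {1}(coord_vbasis (memvf x)) linear_sum sum_lfunE linear_sum mulmx_suml.
apply: eq_bigr => l _; rewrite -[X in coord _ l x *: X](hprojD (vbasis fullv)`_l).
rewrite linearZ linearD /= scale_lfunE (add_lfunE _ _ m) linearZ linearD /=.
by rewrite -scalemxAl mulmxDl -!Pg.
Qed.

Lemma presented_rep (M : smod g) rho : presented M rho -> is_rep superalgebra_rel rho.
Proof.
move=> [Phi [Psi PhiK PsiK] [Ps Pg]] r.
have Pl := fun x m => presented_linext x m Pg.
apply: mulmx_cV_inj => v; rewrite -[v]PsiK mul0mx; set m := Psi v.
have PZ c u : Phi (c *: u) = c *: Phi u by rewrite linearZ.
case: r => [[[p|p]|[p q]]|]; rewrite /superalgebra_rel !nceval_ncsub ?nceval_nclin /=.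
- rewrite mulmxBl -scalemxAl -!mulmxA -Ps -!Pg -Ps; apply/eqP; rewrite subr_eq0; apply/eqP.
  rewrite -PZ; congr (Phi _); move: m; apply: hpart_ind => [u w Eu Ew|b m mb].
    by rewrite !linearD /= Eu Ew.
  rewrite (psgnE _ mb) (psgnE _ (act_graded (gen_graded p) mb)) linearZ /= scalerA -signr_addb.
  by [].
- rewrite scale1r mulmxBl -Pl -Pg; exact: subrr.
- rewrite scale1r mulmxBl mulmxBl -scalemxAl -!mulmxA -!Pg -Pl.
  rewrite (act_lbr _ (gen_graded p) (gen_graded q)) linearB /= PZ.
  exact: subrr.
rewrite scale1r mulmxBl mul1mx -mulmxA -!Ps psgnK; exact: subrr.
Qed.

Lemma presented_iso (M N : smod g) rho rho' T : presented M rho -> presented N rho' ->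
  T \in unitmx -> (forall i, rho i *m T = T *m rho' i) -> smod_iso M N.
Proof.
move=> [Phi [Psi PhiK PsiK] [Ps Pg]] [Phi' [Psi' PhiK' PsiK'] [Ps' Pg']] uT HT.
have Psil : linear Psi' by move=> c u v; apply: (can_inj PhiK'); rewrite linearP /= !PsiK'.
pose f : 'Hom(M, N) := linfun (fun m => Psi' (invmx T *m Phi m)).
have fE m : f m = Psi' (invmx T *m Phi m).
  apply: (linfunE (f := fun m => Psi' (invmx T *m Phi m))) => c u v.
  by rewrite linearP mulmxDr -scalemxAr Psil.
have HT' i : invmx T *m rho i = rho' i *m invmx T.
  by rewrite -[rho i](mulmxK uT) HT !mulmxA mulVmx ?mul1mx.
exists f; split; last first.
  exists (fun n => Psi (T *m Phi' n)) => [m|m].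
    by rewrite fE PsiK' mulKVmx ?PhiK.
  by rewrite fE PsiK mulKmx ?PhiK'.
split=> [a m ma|x m].
  apply: psgn_eig; apply: (can_inj PhiK').
  rewrite Ps' linearZ /= fE PsiK' mulmxA -HT' -mulmxA -Ps (psgnE _ ma) linearZ /=.
  by rewrite -scalemxAr.
apply: (can_inj PhiK').
rewrite !fE PsiK' (presented_linext _ _ Pg) (presented_linext _ _ Pg') PsiK' !mulmxA.
congr (_ *m _); rewrite /linext mulmx_suml mulmx_sumr; apply: eq_bigr => l _.
by rewrite -scalemxAl -scalemxAr mulmxDl mulmxDr !HT'.
Qed.

End SuperalgebraPresentation.

Lemma presented_exists (k : closedFieldType) (g : lieSuper k) (n : nat) (M : smod g) :
  \dim {:M} = n -> exists rho, @presented k g n M rho.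
Proof.
move=> <-; exists (fun i => if i is Some p then mxend (act (gen p)) else mxend (psgn M true)).
have cvE := linfunE (@cvec_linear k M).
exists (linfun (@cvec k M)).
  by exists (@vecc k M) => v; rewrite cvE ?cvecK ?veccK.
by split=> [m|p m]; rewrite !cvE mxend_cvec.
Qed.

Lemma scale_comb (k : fieldType) (V : lmodType k) (c s : k) (A A' B B' C C' D D' : V) :
  c *: A + A' + (c *: B + B') - s *: (c *: C + C' + (c *: D + D')) =
  c *: (A + B - s *: (C + D)) + (A' + B' - s *: (C' + D')).
Proof.
rewrite [c *: A + _ + _]addrACA [c *: C + _ + _]addrACA -!scalerDr.
by rewrite [s *: (c *: _ + _)]scalerDr scalerA mulrC -scalerA opprD addrACA -scalerBr.
Qed.

Section PresentedRigid.
Variables (k : closedFieldType) (g : lieSuper k) (n : nat).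
Hypothesis k_char0 : [pchar k] =i pred0.
Hypothesis g0_ss : ev_semisimple g.
Local Notation d := (\dim {:g}).
Implicit Types (rho f : generator g -> 'M[k]_n).

(** A first-order deformation of the representation is first corrected by an
    inner one so that the grading stays fixed; it is then an even derivation
    of [g] with values in [End(M)]. *)
Lemma presented_rigid (M : smod g) rho : endotrivial M -> presented M rho ->
  rigid (@superalgebra_rel k g) rho.
Proof.
move=> eM pM f0 f0_der; have rep := presented_rep pM.
have [Phi [Psi PhiK PsiK] [Ps Pg]] := pM.
have Pl := fun x m => presented_linext x m Pg.
have PZ c u : Phi (c *: u) = c *: Phi u by rewrite linearZ.
have two0 : (2%:R : k) != 0 by have /pcharf0P -> := k_char0.
pose s := rho None.
have ss : s *m s = 1%:M.
  by have /eqP := rep None; rewrite nceval_ncsub scale1r subr_eq0 => /eqP.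
(* The grading operator is an involution, so the derivation can be made to
   vanish on it. *)
pose T0 := 2%:R^-1 *: (s *m f0 None).
have f0s : s *m f0 None + f0 None *m s = 0.
  by have := f0_der None; rewrite ncder_ncsub /= scaler0 subr0 addrC.
have T0P : f0 None = s *m T0 - T0 *m s.
  have sfs : s *m f0 None *m s = - f0 None.
    have /eqP := f0s; rewrite addr_eq0 => /eqP->.
    by rewrite mulNmx -mulmxA ss mulmx1.
  rewrite -scalemxAr -scalemxAl mulmxA ss mul1mx sfs -scalerBr opprK.
  by rewrite -mulr2n -scaler_nat scalerA mulVf ?scale1r.
pose f i := f0 i - (rho i *m T0 - T0 *m rho i).
have f_der j : ncder rho rho f (superalgebra_rel j) = 0.
  have -> : ncder rho rho f (superalgebra_rel j) = ncder rho rho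
      (fun i => -1 *: (rho i *m T0 - T0 *m rho i) + f0 i) (superalgebra_rel j).
    by apply: eq_ncder => i; rewrite scaleN1r addrC.
  by rewrite ncder_linear ncder_inner rep f0_der mul0mx mulmx0 subrr scaler0 addr0.
have fN : f None = 0 by rewrite /f T0P subrr.
have f_lin p : f (Some p) = linext f (gen p).
  have /eqP := f_der (Some (inl (inr p))).
  by rewrite ncder_ncsub ncder_nclin scale1r subr_eq0 => /eqP.
have f_sgn p : s *m f (Some p) = (-1) ^+ p.1 *: (f (Some p) *m s).
  have /eqP := f_der (Some (inl (inl p))).
  by rewrite ncder_ncsub /= fN mul0mx mulmx0 add0r addr0 subr_eq0 => /eqP.
have f_br p q : linext f (lbr (gen p) (gen q)) =
    f (Some p) *m rho (Some q) + rho (Some p) *m f (Some q) -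
    (-1) ^+ (p.1 && q.1) *: (f (Some q) *m rho (Some p) + rho (Some q) *m f (Some p)).
  have /eqP := f_der (Some (inr (p, q))).
  by rewrite ncder_ncsub ncder_nclin scale1r ncder_ncsub subr_eq0 => /eqP/= <-.
have rho_lin p : rho (Some p) = linext rho (gen p).
  have /eqP := rep (Some (inl (inr p))).
  by rewrite nceval_ncsub nceval_nclin scale1r subr_eq0 => /eqP.
have Psil : linear Psi by move=> c u v; apply: (can_inj PhiK); rewrite linearP /= !PsiK.
pose F1 (A : 'M[k]_n) : 'End(M) := linfun (fun m => Psi (A *m Phi m)).
have F1E A m : Phi (F1 A m) = A *m Phi m.
  rewrite linfunE ?PsiK // => c u v.
  by rewrite linearP mulmxDr -scalemxAr Psil.
pose F : 'Hom(g, 'End(M)) := linfun (fun x => F1 (linext f x)).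
have FE x m : Phi (F x m) = linext f x *m Phi m.
  rewrite -F1E; congr (Phi (fun_of_lfun _ m)).
  apply: (linfunE (f := fun x => F1 (linext f x))) => c u v.
  apply/lfunP => m'; apply: (can_inj PhiK).
  rewrite (add_lfunE _ _ m') (scale_lfunE _ _ m') linearP /= !F1E.
  by rewrite linext_linear mulmxDl -scalemxAl.
have F_deg a x : x \in hpart g a -> hom_deg a (F x).
  move=> xa b m mb; apply: (psgn_eig k_char0); apply: (can_inj PhiK).
  rewrite Ps PZ !FE mulmxA.
  suff -> : s *m linext f x = (-1) ^+ a *: (linext f x *m s).
    rewrite -scalemxAl -mulmxA -Ps (psgnE true mb) PZ -scalemxAr scalerA.
    by rewrite -signr_addb.
  move: x xa; apply: gen_ind => [|c u v Eu Ev|l].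
  - by rewrite -[0 : g]addr0 -[X in X + 0](scale0r 0) linext_linear scale0r add0r;
      rewrite /linext !big1 ?mul0mx ?mulmx0 ?scaler0 // => l _; rewrite linear0 scale0r.
  - rewrite linext_linear mulmxDr mulmxDl -scalemxAr -scalemxAl Eu Ev scalerDr.
    by rewrite !scalerA mulrC.
  - by rewrite -f_lin f_sgn.
have lext0 h : linext h 0 = 0 :> 'M[k]_n.
  by rewrite /linext big1 // => l _; rewrite linear0 scale0r.
have F_cocycle a b x y m : x \in hpart g a -> y \in hpart g b ->
    F (lbr x y) m = F x (act y m) + act x (F y m) -
      (-1) ^+ (a && b) *: (F y (act x m) + act y (F x m)).
  move=> xa yb; apply: (can_inj PhiK).
  rewrite linearB linearD /= PZ linearD /= !FE !Pl !FE !mulmxA -!mulmxDl scalemxAl -mulmxBl.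
  congr (_ *m _).
  move: x xa; apply: gen_ind => [|c u v Eu Ev|l].
  - by rewrite linear0 zero_lfunE !lext0 !mul0mx !mulmx0 !addr0 scaler0 subr0.
  - rewrite linearP add_lfunE scale_lfunE !linext_linear Eu Ev.
    rewrite !(mulmxDl, mulmxDr) -!scalemxAl -!scalemxAr; symmetry.
    exact: scale_comb.
  move: y yb; apply: gen_ind => [|c u v Eu Ev|l'].
  - by rewrite linear0 !lext0 !mul0mx !mulmx0 !addr0 scaler0 subr0.
  - rewrite linearP !linext_linear Eu Ev !(mulmxDl, mulmxDr) -!scalemxAl -!scalemxAr.
    by symmetry; exact: scale_comb.
  by rewrite /= f_br -?f_lin -?rho_lin.
have [T Tdeg TF] := endotrivial_cocycle_inner k_char0 g0_ss F_deg F_cocycle eM.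
pose T1 : 'M[k]_n := lin1_mx (fun u : 'rV[k]_n => (Phi (T (Psi u^T)))^T).
have T1E m : T1^T *m Phi m = Phi (T m).
  have Tl : linear (fun u : 'rV[k]_n => (Phi (T (Psi u^T)))^T).
    by move=> c u v; rewrite linearP Psil !linearP.
  pose L := HB.pack_for {linear 'rV[k]_n -> 'rV[k]_n} (fun u : 'rV[k]_n => (Phi (T (Psi u^T)))^T)
    (GRing.isLinear.Build _ _ _ _ _ Tl).
  apply: trmx_inj; rewrite trmx_mul trmxK (mul_rV_lin1 L) /=.
  by rewrite trmxK PhiK.
exists (T0 - T1^T) => i.
have -> : f0 i = f i + (rho i *m T0 - T0 *m rho i) by rewrite subrK.
rewrite mulmxBl mulmxBr opprB [in RHS]addrA [RHS](ACl (3*2*(1*4))) /=; congr (_ + _).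
apply: mulmx_cV_inj => v; rewrite -[v]PsiK [RHS]mulmxBl -!mulmxA; set m := Psi v.
case: i => [p|].
  by rewrite f_lin -FE TF -Pg !T1E -Pg linearB.
rewrite fN mul0mx -Ps !T1E -Ps; apply/esym/eqP; rewrite subr_eq0; apply/eqP.
congr (Phi _); move: m; apply: hpart_ind => [u w Eu Ew|b m mb].
  by rewrite !linearD /= Eu Ew.
by rewrite (psgnE _ mb) (psgnE _ (Tdeg _ _ mb)) linearZ.
Qed.

End PresentedRigid.

Theorem corollary7p9 (k : closedFieldType) (k_char0 : [pchar k] =i pred0)
    (g : lieSuper k) (g_classical : classical g)
    (g0_semisimple : ev_semisimple g) (n : int) :
  exists (N : nat) (L : 'I_N -> smod g),
    forall M : smod g, endotrivial M -> (\dim {:M})%:Z = n ->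
      exists i : 'I_N, smod_iso M (L i).
Proof.
case: n => n; last by exists 0%N, (fun=> kev g).
have [||N [L HL]] := @finitely_many_rigid k (generator g) (relation g)
  (@superalgebra_rel k g) n (smod g * (generator g -> 'M[k]_n)) snd
  (fun s => endotrivial s.1 /\ presented s.1 s.2) (fun s t => smod_iso s.1 t.1).
- move=> s [es ps]; split; first exact: presented_rep ps.
  exact: (presented_rigid k_char0 g0_semisimple es ps).
- by move=> s t T [_ ps] [_ pt]; exact: (presented_iso k_char0 pt ps).
exists N, (fun i => (L i).1) => M eM [dM].
have [rho pM] := presented_exists dM.
by have [i iso] := HL (M, rho) (conj eM pM); exists i.
Qed.
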